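(* Suppose $R$ is a numerical semigroup ring of minimal multiplicity with homogeneous canonical ideal $I$. Let $x_1,\dots,x_r$ be a minimal homogeneous generating set for $I$ with $|x_1|<|x_2|<\cdots<|x_r|$ and set $y=t^{a_1}$. Then the following are equivalent: (1) $R$ is almost Gorenstein, i.e., $\mathfrak m\subseteq(x_1:I)$. (2) $R$ is nearly Gorenstein. (3) $\mathfrak m\operatorname{Ext}^i_R(I,R)=0$ for all $i>0$. (4) $\mathfrak m\operatorname{Ext}^1_R(I,R)=0$. (5) $\mathfrak m\operatorname{Tor}^R_1(I,R/I)=0$. (6) $\mathfrak m\bigwedge^2_R(I)=0$. (7) $\mathfrak m B_1(I)\subseteq IZ_1(I)$. (8) $yB_1(I)\subseteq IZ_1(I)$. (9) $y\in(x_1:I)$. (10) $y\operatorname{Ext}^i_R(I,R)=0$ for all $i>0$. (11) $y\operatorname{Ext}^1_R(I,R)=0$. (12) $y\operatorname{Tor}^R_1(I,R/I)=0$. (13) $y\bigwedge^2_R(I)=0$. (14) $y\in\operatorname{tr}_R(I)$. (15) There is an ideal $L$ of $R$ with $I\cong L$ such that $y\in L$. (16) There is an isomorphism $Z_1(I)\cong\bigoplus_{i=2}^r\mathfrak m(-|x_i|)$ of graded $R$-modules.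
   Context: Let $k$ be a field and $a_1<a_2<\dots<a_s$ positive integers with $\gcd(a_1,\dots,a_s)=1$. A numerical semigroup ring is either the positively graded ring $R=k[t^{a_1},\dots,t^{a_s}]$ (with $\deg t=1$) or its completion $k[\![t^{a_1},\dots,t^{a_s}]\!]$; $\mathfrak m=(t^{a_1},\dots,t^{a_s})$. In the complete case a homogeneous ideal means one extended from a homogeneous ideal of the graded ring, and statements about degrees or graded isomorphisms are understood over the graded ring. The multiplicity is $e(R)=a_1$; $R$ has minimal multiplicity if $e(R)=\mu_R(\mathfrak m)$, the minimal number of generators of $\mathfrak m$. $|x|$ is the degree of a homogeneous element $x$. A canonical ideal is an ideal isomorphic to the canonical module $\omega_R$. $\operatorname{tr}_R(M)=\langle f(u)\mid u\in M,f\in\operatorname{Hom}_R(M,R)\rangle$; $R$ is nearly Gorenstein if $\operatorname{tr}_R(\omega_R)\supseteq\mathfrak m$. $(x_1:I)=\{a\in R\mid aI\subseteq(x_1)\}$. $F=\bigoplus_{i=1}^r Re_i$ is the graded free module with $\deg e_i=|x_i|$, mapping onto $I$ by $e_i\mapsto x_i$; $Z_1(I)$ is the kernel of this map (first Koszul cycles) and $B_1(I)$ is the submodule generated by all $x_ie_j-x_je_i$ (first Koszul boundaries). $M(-d)$ denotes the graded shift, $M(-d)_j=M_{j-d}$. *)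

(* Defs.v *)
From HB Require Import structures.
From mathcomp Require Import all_boot all_order all_algebra.
From mathcomp Require Import boolp classical_sets functions.
From mathcomp Require Import freeg.

Set Implicit Arguments.
Unset Strict Implicit.
Unset Printing Implicit Defensive.
Import GRing.Theory.

Local Open Scope ring_scope.
Local Open Scope quotient_scope.

(** * Submodules, quotients, spans *)

Definition submod (R : comNzRingType) (V : lmodType R) (S : submodClosed V) :=
  {v : V | v \in S}.

HB.instance Definition _ (R : comNzRingType) (V : lmodType R)
    (S : submodClosed V) := SubChoice.on (submod S).
HB.instance Definition _ (R : comNzRingType) (V : lmodType R)
    (S : submodClosed V) := [SubChoice_isSubLmodule of submod S by <:].

Notation ideal R := (submodClosed R^o).

Section QuotientModule.
Variables (R : comNzRingType) (V : lmodType R) (S : submodClosed V).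

Definition zsub : V -> bool := fun v => v \in S.

Lemma zsub_zmod_closed : zmod_closed zsub.
Proof. exact: GRing.submod_closedB (GRing.submodClosedP S). Qed.
HB.instance Definition _ := GRing.isZmodClosed.Build V zsub zsub_zmod_closed.

Definition quotmod := Quotient.quot (GRing.ZmodClosed.clone V zsub _).
HB.instance Definition _ := ZmodQuotient.on quotmod.

Definition quot_scale (a : R) : quotmod -> quotmod :=
  fun q => \pi_quotmod (a *: repr q).

Lemma quotmodP (u v : V) : (\pi_quotmod u = \pi_quotmod v) <-> (u - v \in S).
Proof.
split=> [/eqP|uv]; first by rewrite -Quotient.idealrBE.
by apply/eqP; rewrite -Quotient.idealrBE.
Qed.

Lemma repr_quotmod (u : V) : u - repr (\pi_quotmod u) \in S.
Proof. by apply/quotmodP; rewrite reprK. Qed.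

Lemma pi_scale a u : \pi_quotmod (a *: u) = quot_scale a (\pi_quotmod u).
Proof. by apply/quotmodP; rewrite -scalerBr; apply/rpredZ/repr_quotmod. Qed.

Lemma quotmod_ind (P : quotmod -> Prop) :
  (forall v, P (\pi_quotmod v)) -> forall q, P q.
Proof. by move=> Ppi q; rewrite -[q]reprK. Qed.

Lemma pi_add u v : \pi_quotmod (u + v) = \pi_quotmod u + \pi_quotmod v.
Proof. exact: (raddfD (\pi_quotmod)). Qed.

Lemma quot_scaleA a b q : quot_scale a (quot_scale b q) = quot_scale (a * b) q.
Proof.
elim/quotmod_ind: q => v.
by rewrite -(pi_scale b) -(pi_scale a) -(pi_scale (a * b)) scalerA.
Qed.
Lemma quot_scale1 : left_id 1 quot_scale.
Proof. by elim/quotmod_ind=> v; rewrite -(pi_scale 1) scale1r. Qed.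
Lemma quot_scaleDr : right_distributive quot_scale +%R.
Proof.
move=> a; elim/quotmod_ind=> u; elim/quotmod_ind=> v.
by rewrite -!(pi_scale a) -!pi_add -(pi_scale a) scalerDr.
Qed.
Lemma quot_scaleDl q : {morph quot_scale^~ q : a b / a + b}.
Proof.
move=> a b; elim/quotmod_ind: q => v.
by rewrite -(pi_scale a) -(pi_scale b) -(pi_scale (a + b)) -pi_add scalerDl.
Qed.
HB.instance Definition _ := GRing.Zmodule_isLmodule.Build R quotmod
  quot_scaleA quot_scale1 quot_scaleDr quot_scaleDl.

Lemma pi_linear : linear (\pi_quotmod : V -> quotmod).
Proof. by move=> a u v; rewrite pi_add pi_scale. Qed.
HB.instance Definition _ :=
  GRing.isLinear.Build R V quotmod _ (\pi_quotmod) pi_linear.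

Definition quot_lift (W : lmodType R) (f : {linear V -> W})
    (fS : forall v, v \in S -> f v = 0) (q : quotmod) : W := f (repr q).

Lemma quot_lift_pi (W : lmodType R) (f : {linear V -> W})
    (fS : forall v, v \in S -> f v = 0) v :
  quot_lift fS (\pi_quotmod v) = f v.
Proof.
by apply/esym/eqP; rewrite -subr_eq0 -linearB; apply/eqP/fS/repr_quotmod.
Qed.

Lemma quot_lift_linear (W : lmodType R) (f : {linear V -> W})
    (fS : forall v, v \in S -> f v = 0) : linear (quot_lift fS).
Proof.
move=> a; elim/quotmod_ind=> u; elim/quotmod_ind=> v.
by rewrite -pi_linear !quot_lift_pi linearP.
Qed.
HB.instance Definition _ (W : lmodType R) (f : {linear V -> W})
    (fS : forall v, v \in S -> f v = 0) :=
  GRing.isLinear.Build R quotmod W _ (quot_lift fS) (quot_lift_linear fS).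

End QuotientModule.

Definition mkSubmod (R : comNzRingType) (V : lmodType R) (P : V -> bool)
    (P_closed : subsemimod_closed P) : submodClosed V :=
  HB.pack P (GRing.isSubmodClosed.Build R V P P_closed).

Section Submodules.
Variable R : comNzRingType.
Implicit Types U V W : lmodType R.

Lemma spanm_closed V (X : set V) : subsemimod_closed (fun u : V =>
  `[< forall S : submodClosed V, (forall v, X v -> v \in S) -> u \in S >]).
Proof.
split; first split.
- by apply/asboolP=> S _; exact: rpred0.
- move=> u v /asboolP uX /asboolP vX; apply/asboolP=> S XS.
  by apply: rpredD; [exact: uX | exact: vX].
- move=> a u /asboolP uX; apply/asboolP=> S XS.
  by apply: rpredZ; exact: uX.
Qed.
Definition spanm V (X : set V) : submodClosed V := mkSubmod (spanm_closed X).

Lemma ker_closed V W (f : {linear V -> W}) :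
  subsemimod_closed (fun v => f v == 0).
Proof.
split; first split.
- by apply/eqP; exact: linear0.
- move=> u v /eqP fu /eqP fv; apply/eqP.
  by rewrite linearD fu fv addr0.
- by move=> a u /eqP fu; apply/eqP; rewrite linearZ /= fu scaler0.
Qed.
Definition ker V W (f : {linear V -> W}) : submodClosed V :=
  mkSubmod (ker_closed f).

Lemma boundary_closed U V W (f : {linear U -> V}) (g : {linear V -> W}) :
  subsemimod_closed (fun z : submod (ker g) => `[< exists u, f u = val z >]).
Proof.
split; first split.
- by apply/asboolP; exists 0; rewrite !linear0.
- move=> y z /asboolP[u fu] /asboolP[v fv].
  by apply/asboolP; exists (u + v); rewrite !linearD fu fv.
- move=> a z /asboolP[u fu].
  by apply/asboolP; exists (a *: u); rewrite !linearZ /= fu.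
Qed.

(* For a complex U -f-> V -g-> W this is ker g / im f. *)
Definition homology U V W (f : {linear U -> V}) (g : {linear V -> W}) :
  lmodType R := quotmod (mkSubmod (boundary_closed f g)).

Definition isom V W : Prop := exists f : {linear V -> W}, bijective f.

Definition ann (z : R) V : Prop := forall v : V, z *: v = 0.

End Submodules.

Section HomologicalAlgebra.
Variable R : comNzRingType.
Implicit Types M N V W : lmodType R.

(** ** Hom *)

Lemma linear_fun_closed M N :
  subsemimod_closed (fun f : M -> N => `[< linear f >]).
Proof.
split; first split.
- by apply/asboolP=> a u v; rewrite /= scaler0 addr0.
- move=> f g /asboolP fL /asboolP gL; apply/asboolP=> a u v.
  by rewrite addrfctE fL gL scalerDr addrACA.
- move=> c f /asboolP fL; apply/asboolP=> a u v.
  by rewrite scalrfctE fL scalerDr !scalerA mulrC.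
Qed.

Definition Hom M N : lmodType R := submod (mkSubmod (@linear_fun_closed M N)).

Lemma precomp_subproof M M' N (f : {linear M' -> M}) (g : Hom M N) :
  val g \o f \in mkSubmod (@linear_fun_closed M' N).
Proof.
apply/asboolP => a u v; have /asboolP gL := valP g.
by rewrite /= linearP gL.
Qed.

Definition precomp M M' N (f : {linear M' -> M}) (g : Hom M N) : Hom M' N :=
  exist _ (val g \o f) (precomp_subproof f g).

Lemma precomp_linear M M' N (f : {linear M' -> M}) :
  linear (@precomp M M' N f).
Proof. by move=> a g h; apply/val_inj. Qed.
HB.instance Definition _ M M' N (f : {linear M' -> M}) :=
  GRing.isLinear.Build R (Hom M N) (Hom M' N) _ (@precomp M M' N f)
    (@precomp_linear M M' N f).

(** ** Free modules *)

Definition freemod (K : choiceType) : lmodType R := {freeg K / R}.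

Section FreeLift.
Variables (K : choiceType) (M : lmodType R) (f : K -> M).

HB.instance Definition _ := GRing.isZmodMorphism.Build (freemod K) M
  (fglift f : freemod K -> M) (lift_is_additive f).

Lemma fglift_scalable : scalable (fglift f : freemod K -> M).
Proof.
move=> a D; rewrite -{2}[D]freeg_sumE.
rewrite [in RHS]raddf_sum scaler_sumr.
rewrite [a *: D]/GRing.scale /= /fgscale.
rewrite (raddf_sum (fglift f : freemod K -> M)).
apply: eq_bigr => x _; rewrite -[LHS]/(fglift f _) liftU.
by rewrite -[X in _ = _ *: X]/(fglift f _) liftU scalerA.
Qed.

HB.instance Definition _ := GRing.isScalable.Build R (freemod K) M _
  (fglift f : freemod K -> M) fglift_scalable.

End FreeLift.

(** ** Standard free resolution and Ext *)

(* The map <<u>> |-> u on the free module with basis the set M. *)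
Definition aug M : {linear freemod M -> M} := fglift idfun.

(* The resolution with terms res n M = free module on the set syz n M, where
   syz n.+1 M is the kernel of the augmentation res n M -> syz n M; Ext and Tor
   below are the (co)homology of the complexes it yields. *)
Definition syz (n : nat) M : lmodType R :=
  iter n (fun N => submod (ker (aug N))) M.

Definition res (n : nat) M : lmodType R := freemod (syz n M).

Definition res_d (n : nat) M : {linear res n.+1 M -> res n M} :=
  (val : syz n.+1 M -> res n M) \o aug (syz n.+1 M).

Definition cores_d (n : nat) M N :
    {linear Hom (res n M) N -> Hom (res n.+1 M) N} :=
  @precomp _ _ N (res_d n M).

Definition Ext (n : nat) M N : lmodType R :=
  if n is n'.+1 then homology (cores_d n' M N) (cores_d n'.+1 M N)
  else homology (\0 : Hom (res 0 M) N -> Hom (res 0 M) N) (cores_d 0 M N).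

(** ** Tensor products and Tor *)

Inductive bilinear_rel M N : set (freemod (M * N)%type) :=
| Rel_addl u u' v : bilinear_rel (<<(u + u', v)>> - <<(u, v)>> - <<(u', v)>>)
| Rel_addr u v v' : bilinear_rel (<<(u, v + v')>> - <<(u, v)>> - <<(u, v')>>)
| Rel_scalel a u v : bilinear_rel (<<(a *: u, v)>> - a *: <<(u, v)>>)
| Rel_scaler a u v : bilinear_rel (<<(u, a *: v)>> - a *: <<(u, v)>>).

Definition tensor M N : lmodType R :=
  quotmod (spanm (@bilinear_rel M N)).

Definition tens M N (u : M) (v : N) : tensor M N :=
  \pi_(quotmod (spanm (@bilinear_rel M N))) <<(u, v)>>.

Lemma sub_spanm V (X : set V) v : X v -> v \in spanm X.
Proof. by move=> Xv; apply/asboolP=> S; apply. Qed.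

Lemma spanm_ind V (X : set V) (S : submodClosed V) :
  (forall v, X v -> v \in S) -> forall v, v \in spanm X -> v \in S.
Proof. by move=> XS v /asboolP; apply. Qed.

Section TensBilinear.
Variables M N : lmodType R.
Implicit Types (u : M) (v : N).

Lemma tensDl u u' v : tens (u + u') v = tens u v + tens u' v.
Proof.
rewrite -pi_add; apply/quotmodP/sub_spanm.
by rewrite opprD addrA; exact: Rel_addl.
Qed.

Lemma tensDr u v v' : tens u (v + v') = tens u v + tens u v'.
Proof.
rewrite -pi_add; apply/quotmodP/sub_spanm.
by rewrite opprD addrA; exact: Rel_addr.
Qed.

Lemma tensZl a u v : tens (a *: u) v = a *: tens u v.
Proof. rewrite -[RHS]pi_scale; apply/quotmodP/sub_spanm; exact: Rel_scalel. Qed.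

Lemma tensZr a u v : tens u (a *: v) = a *: tens u v.
Proof. rewrite -[RHS]pi_scale; apply/quotmodP/sub_spanm; exact: Rel_scaler. Qed.

End TensBilinear.

Section TensorMap.
Variables (M M' N : lmodType R) (f : {linear M -> M'}).

Definition pre_tensor_map : {linear freemod (M * N)%type -> tensor M' N} :=
  fglift (fun w : M * N => tens (f w.1) w.2).

Lemma pre_tensor_map_rel v :
  v \in spanm (@bilinear_rel M N) -> pre_tensor_map v = 0.
Proof.
move=> v_rel; apply/eqP; move: v v_rel.
apply: (@spanm_ind _ _ (ker pre_tensor_map)).
move=> _ [u u' w|u w w'|a u w|a u w]; apply/eqP; rewrite ?linearB ?linearZ /=.
- by rewrite !liftU !scale1r /= linearD tensDl addrAC addrK subrr.
- by rewrite !liftU !scale1r /= tensDr addrAC addrK subrr.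
- by rewrite !liftU !scale1r /= linearZ /= tensZl scalerN subrr.
- by rewrite !liftU !scale1r /= tensZr scalerN subrr.
Qed.

(* f (x) id_N *)
Definition tensor_map : {linear tensor M N -> tensor M' N} :=
  quot_lift pre_tensor_map_rel.

End TensorMap.

Definition Tor (n : nat) M N : lmodType R :=
  if n is n'.+1 then
    homology (tensor_map N (res_d n'.+1 M)) (tensor_map N (res_d n' M))
  else homology (tensor_map N (res_d 0 M))
         (\0 : tensor (res 0 M) N -> tensor (res 0 M) N).

Definition ext2 M : lmodType R :=
  quotmod (spanm [set w : tensor M M | exists u, w = tens u u]).

Definition trace M : ideal R :=
  spanm [set a : R^o | exists (f : {linear M -> R^o}) (u : M), a = f u].

End HomologicalAlgebra.

Section IdealNotions.
Variable R : comNzRingType.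
Implicit Types (V M : lmodType R) (I : ideal R).

Definition generates V (n : nat) (v : 'I_n -> V) (S : submodClosed V) : Prop :=
  S =i spanm (range v).

Definition min_generates V (n : nat) (v : 'I_n -> V) (S : submodClosed V) :
    Prop :=
  generates v S /\ forall i, v i \notin spanm (v @` [set j | j != i]).

(* mu_R(S) = n *)
Definition is_mu V (S : submodClosed V) (n : nat) : Prop :=
  (exists v : 'I_n -> V, generates v S) /\
  (forall n' (v : 'I_n' -> V), generates v S -> (n <= n')%N).

Definition fin_gen M : Prop :=
  exists n (v : 'I_n -> M), forall u, u \in spanm (range v).

(* The canonical module of a one-dimensional Cohen-Macaulay ring R that is
   (graded) local with maximal ideal m and residue field K = R / m : a finitely
   generated module W with Ext^1(K, W) = K and Ext^i(K, W) = 0 for i <> 1. *)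
Definition canonical_module (m : ideal R) M : Prop :=
  [/\ fin_gen M,
      isom (Ext 1 (quotmod m) M) (quotmod m) &
      forall i, i != 1%N -> forall e : Ext i (quotmod m) M, e = 0].

Definition colon (x : R) I : set R :=
  [set a | forall u : R^o, u \in I -> a *: u \in spanm [set x : R^o]].

Definition smulm V I (S : submodClosed V) : submodClosed V :=
  spanm [set w | exists a u, [/\ a \in I, u \in S & w = (a : R) *: u]].

Section Koszul.
Variables (n : nat) (x : 'I_n -> R).

Definition dot (u : {ffun 'I_n -> R^o}) : R^o := \sum_i u i *: (x i : R^o).

Lemma dot_linear : linear dot.
Proof.
move=> a u v; rewrite /dot scaler_sumr -big_split /=.
by apply: eq_bigr => i _; rewrite !ffunE scalerDl scalerA.
Qed.
HB.instance Definition _ :=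
  GRing.isLinear.Build R {ffun 'I_n -> R^o} R^o _ dot dot_linear.

Definition Z1 : submodClosed {ffun 'I_n -> R^o} := ker dot.

Definition stdvec (i : 'I_n) : {ffun 'I_n -> R^o} := [ffun j => (j == i)%:R].

Definition B1 : submodClosed {ffun 'I_n -> R^o} :=
  spanm [set w | exists i j, w = x i *: stdvec j - x j *: stdvec i].

End Koszul.
End IdealNotions.

(** * Graded modules *)

(* A module with a family of homogeneous components. *)
Record gradedModule (R : comNzRingType) := GradedModule {
  gsort :> lmodType R;
  gpart : int -> set gsort
}.

Section GradedModules.
Variable R : comNzRingType.
Implicit Types M N : gradedModule R.

Definition gsubmod M (S : submodClosed M) : gradedModule R :=
  @GradedModule R (submod S) (fun j u => gpart j (val u)).

(* The direct sum of the shifts M(- d i), where M(- e)_j = M_(j - e). *)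
Definition gsum_shift M (n : nat) (d : 'I_n -> nat) : gradedModule R :=
  @GradedModule R {ffun 'I_n -> M}
    (fun j u => forall i, gpart (j - (d i)%:Z) (u i)).

Definition gisom M N : Prop :=
  exists2 f : {linear M -> N},
    bijective f & forall j u, gpart j (f u) <-> gpart j u.

End GradedModules.

(** * Formal power series *)

Definition fps (k : comNzRingType) := nat -> k.

Section PowerSeries.
Variable k : comNzRingType.
Implicit Types f g h : fps k.

HB.instance Definition _ := GRing.Zmodule.copy (fps k) (nat -> k).

Definition fps_one : fps k := fun n => (n == 0%N)%:R.
Definition fps_mul f g : fps k := fun n => \sum_(i < n.+1) f i * g (n - i)%N.

Definition fps_trunc (n : nat) f : {poly k} := \poly_(i < n.+1) f i.

Lemma coef_fps_trunc n f i : (i <= n)%N -> (fps_trunc n f)`_i = f i.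
Proof. by move=> le_in; rewrite coef_poly ltnS le_in. Qed.

Lemma fps_mulE n f g i : (i <= n)%N ->
  fps_mul f g i = (fps_trunc n f * fps_trunc n g)`_i.
Proof.
move=> le_in; rewrite coefM; apply: eq_bigr => j _.
rewrite !coef_fps_trunc ?(leq_trans (leq_subr _ _)) //.
by rewrite (leq_trans _ le_in) // -ltnS.
Qed.

Lemma fps_mulA : associative fps_mul.
Proof.
move=> f g h; apply/funext=> n.
have -> : fps_mul f (fps_mul g h) n =
    (fps_trunc n f * (fps_trunc n g * fps_trunc n h))`_n.
  rewrite coefM; apply: eq_bigr => i _.
  have le_in : (i <= n)%N by rewrite -ltnS.
  by rewrite (coef_fps_trunc f le_in) (fps_mulE g h (leq_subr i n)).
have -> : fps_mul (fps_mul f g) h n =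
    (fps_trunc n f * fps_trunc n g * fps_trunc n h)`_n.
  rewrite coefM; apply: eq_bigr => i _.
  have le_in : (i <= n)%N by rewrite -ltnS.
  by rewrite (coef_fps_trunc h (leq_subr i n)) (fps_mulE f g le_in).
by rewrite mulrA.
Qed.

Lemma fps_mulC : commutative fps_mul.
Proof.
by move=> f g; apply/funext=> n; rewrite !(fps_mulE _ _ (leqnn n)) mulrC.
Qed.

Lemma fps_mul1 : left_id fps_one fps_mul.
Proof.
move=> f; apply/funext=> n; rewrite /fps_mul big_ord_recl /= mul1r subn0.
by rewrite big1 ?addr0 // => i _; rewrite mul0r.
Qed.

Lemma fps_mulDl : left_distributive fps_mul +%R.
Proof.
move=> f g h; apply/funext=> n; rewrite -[RHS]/(fps_mul f h n + fps_mul g h n).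
rewrite /fps_mul -big_split /=; apply: eq_bigr => i _.
by rewrite -[(f + g) i]/(f i + g i) mulrDl.
Qed.

Lemma fps_one_neq0 : fps_one != 0.
Proof. by apply/eqP => /(congr1 (@^~ 0%N)) /eqP; rewrite oner_eq0. Qed.

HB.instance Definition _ := GRing.Zmodule_isComNzRing.Build (fps k)
  fps_mulA fps_mulC fps_mul1 fps_mulDl fps_one_neq0.

End PowerSeries.

(** * Numerical semigroup rings *)

Definition mkSubring (A : comNzRingType) (P : A -> bool)
    (P_closed : subring_closed P) : subringClosed A :=
  HB.pack P (GRing.isSubringClosed.Build A P P_closed).

Section SemigroupRing.
Variables (k : fieldType) (s : nat) (a : 'I_s.+1 -> nat).

(* The numerical semigroup generated by the a i. *)
Definition in_sg : set nat :=
  [set n | exists c : 'I_s.+1 -> nat, n = (\sum_i c i * a i)%N].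

Lemma in_sg0 : in_sg 0.
Proof. by exists (fun=> 0%N); rewrite big1. Qed.

Lemma in_sgD m n : in_sg m -> in_sg n -> in_sg (m + n).
Proof.
move=> [b ->] [c ->]; exists (fun i => b i + c i)%N.
by rewrite -big_split; apply: eq_bigr => i _; rewrite mulnDl.
Qed.

Lemma in_sg_gen i : in_sg (a i).
Proof.
exists (fun j => (j == i)%N); rewrite (bigD1 i) //= eqxx mul1n big1 ?addn0 //.
by move=> j /negPf->.
Qed.

(* k[t^a_1, ..., t^a_s] consists of the polynomials supported on the semigroup
   (see sg_polyP), its completion of the power series supported on it. *)
Definition sg_poly (p : {poly k}) : bool :=
  `[< forall n, p`_n != 0 -> in_sg n >].
Definition sg_fps (f : fps k) : bool :=
  `[< forall n, f n != 0 -> in_sg n >].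

Lemma sg_conv (f g : nat -> k) n :
  (forall n, f n != 0 -> in_sg n) -> (forall n, g n != 0 -> in_sg n) ->
  \sum_(i < n.+1) f i * g (n - i)%N != 0 -> in_sg n.
Proof.
move=> f_sg g_sg fg_n; apply: contrapT => n_sg; case/eqP: fg_n.
apply: big1 => i _; apply/eqP/negPn/negP; rewrite mulf_eq0 negb_or.
move=> /andP[/f_sg i_sg /g_sg ni_sg]; apply: n_sg.
by rewrite -(subnKC (ltn_ord i : i <= n)%N); exact: in_sgD.
Qed.

Lemma sg_poly_closed : subring_closed sg_poly.
Proof.
split.
- apply/asboolP=> n; rewrite coef1.
  case: (eqVneq n 0%N) => [-> _|]; [exact: in_sg0 | by rewrite eqxx].
- move=> p q /asboolP p_sg /asboolP q_sg; apply/asboolP=> n; rewrite coefB.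
  case: (eqVneq p`_n 0) => [->|/p_sg //]; rewrite sub0r oppr_eq0; exact: q_sg.
- move=> p q /asboolP p_sg /asboolP q_sg; apply/asboolP=> n; rewrite coefM.
  exact: sg_conv.
Qed.

Lemma sg_fps_closed : subring_closed sg_fps.
Proof.
split.
- apply/asboolP=> n; rewrite -[X in X != 0]/((n == 0%N)%:R : k).
  case: (eqVneq n 0%N) => [-> _|]; [exact: in_sg0 | by rewrite eqxx].
- move=> f g /asboolP f_sg /asboolP g_sg; apply/asboolP=> n.
  rewrite -[X in X != 0]/(f n - g n).
  case: (eqVneq (f n) 0) => [->|/f_sg //]; rewrite sub0r oppr_eq0; exact: g_sg.
- move=> f g /asboolP f_sg /asboolP g_sg; apply/asboolP=> n.
  exact: sg_conv.
Qed.

Lemma sg_polyP (p : {poly k}) :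
  sg_poly p <-> forall S : subringClosed {poly k},
    (forall c : k, c%:P \in S) -> (forall i, 'X^(a i) \in S) -> p \in S.
Proof.
split=> [/asboolP p_sg S S_const S_gen|]; last first.
  move/(_ (mkSubring sg_poly_closed)); apply.
    move=> c; apply/asboolP=> n; rewrite coefC.
    case: (eqVneq n 0%N) => [-> _|]; [exact: in_sg0 | by rewrite eqxx].
  move=> i; apply/asboolP=> n; rewrite coefXn.
  by case: (eqVneq n (a i)) => [-> _|]; [exact: in_sg_gen | rewrite eqxx].
rewrite -[p]coefK poly_def; apply: rpred_sum => n _.
rewrite -mul_polyC; case: (eqVneq p`_n 0) => [->|/p_sg [c ->]].
  by rewrite mul0r rpred0.
apply: rpredM => //; rewrite expr_sum; apply: rpred_prod => i _.
by rewrite mulnC exprM; apply: rpredX.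
Qed.

Definition graded_sgring := {p : {poly k} | p \in mkSubring sg_poly_closed}.
HB.instance Definition _ := SubChoice.on graded_sgring.
HB.instance Definition _ := [SubChoice_isSubComNzRing of graded_sgring by <:].

Definition complete_sgring := {f : fps k | f \in mkSubring sg_fps_closed}.
HB.instance Definition _ := SubChoice.on complete_sgring.
HB.instance Definition _ :=
  [SubChoice_isSubComNzRing of complete_sgring by <:].

Lemma complete_subproof (p : graded_sgring) :
  (fun n => (val p)`_n) \in mkSubring sg_fps_closed.
Proof. by apply/asboolP; have /asboolP := valP p. Qed.

Definition to_complete (p : graded_sgring) : complete_sgring :=
  Sub (fun n => (val p)`_n : k) (complete_subproof p).

Lemma gen_subproof i : 'X^(a i) \in mkSubring sg_poly_closed.
Proof.
apply/asboolP=> n; rewrite coefXn.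
by case: (eqVneq n (a i)) => [-> _|]; [exact: in_sg_gen | rewrite eqxx].
Qed.

(* t^(a_i) *)
Definition tpow (i : 'I_s.+1) : graded_sgring :=
  Sub 'X^(a i) (gen_subproof i).

Variant flavor := Graded | Complete.

Definition sgring (fl : flavor) : comNzRingType :=
  match fl with Graded => graded_sgring | Complete => complete_sgring end.

Definition iota_sg (fl : flavor) : graded_sgring -> sgring fl :=
  match fl with Graded => idfun | Complete => to_complete end.

Definition maxideal (fl : flavor) : ideal (sgring fl) :=
  spanm (range (fun i => iota_sg fl (tpow i) : (sgring fl)^o)).

(* e(R) = a_1 = mu_R(m) *)
Definition minimal_multiplicity (fl : flavor) : Prop :=
  is_mu (maxideal fl) (a ord0).

(* p is homogeneous of degree j (or zero). *)
Definition homog (j : int) : set graded_sgring :=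
  [set p : graded_sgring | forall n : nat, (val p)`_n != 0 -> n%:Z = j].

Definition graded_self : gradedModule graded_sgring :=
  @GradedModule graded_sgring graded_sgring^o homog.

Definition homogeneous_ideal (fl : flavor) (I : ideal (sgring fl)) : Prop :=
  exists X : set graded_sgring,
    (forall p, X p -> exists j, homog j p) /\
    I =i spanm (iota_sg fl @` X : set (sgring fl)^o).

End SemigroupRing.

(* Main.v *)
(** Everything is read off exponents. Let S be the semigroup, e its
    multiplicity, d_1 < ... < d_r the degrees of the generators of I. Condition
    (9) says that e + d_i lies in d_1 + S for all i; as minimal multiplicity
    gives s + s' - e in S for nonzero s, s' in S, this already implies (1).
    If z I lies in (x_1), then multiplication by z on I factors through R, so z
    kills Ext^i(I, -) and Tor_i(I, -) for i > 0; under (1) the projection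
    forgetting e_1 is an isomorphism from Z_1(I) to a sum of copies of m.
    Conversely, if (9) fails, there is x_j such that y x_j lies in no (x_i) with
    i <> j. This x_j defeats every other condition: y (x_1 e_j - x_j e_1) is not
    in I Z_1(I); truncating at 1 and y two coordinates of I yields linear maps
    I -> k[y]/(y^2) whose wedge is nonzero at (y x_1, x_j); and Z_1(I) has
    dimension one less than the sum of the m(-d_i) in degree e + d_j. For
    Ext^1(I, R), the canonical hypothesis enters: Ext^1(k, I) being cyclic
    forces n + d_1 to lie outside the exponents of I for n the Frobenius number
    of S, so z |-> t^(n - e) z_j is a map Z_1(I) -> R, and y times it does not
    extend to the free module. *)

From HB Require Import structures.
Require Import Defs.
From mathcomp Require Import freeg.
From mathcomp Require Import all_boot all_order all_algebra.
From mathcomp Require Import boolp classical_sets functions.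
From mathcomp Require Import zify ring.

Set Implicit Arguments.
Unset Strict Implicit.
Unset Printing Implicit Defensive.
Import GRing.Theory.

Local Open Scope classical_set_scope.
Local Open Scope ring_scope.
Local Open Scope quotient_scope.

(** * Standard resolutions *)

Section FreeModules.
Variable R : comNzRingType.
Implicit Types M N U V W : lmodType R.

Definition mkLinear V W (f : V -> W) (fL : linear f) : {linear V -> W} :=
  HB.pack f (GRing.isLinear.Build R V W _ f fL).

Lemma fglift_basis (K : choiceType) M (f : K -> M) x :
  (fglift f : {linear freemod R K -> M}) << x >> = f x.
Proof. by rewrite /= liftU scale1r. Qed.

Lemma freemod_sumE (K : choiceType) (u : freemod R K) :
  u = \sum_(x <- dom u) coeff x u *: (<< x >> : freemod R K).
Proof.
rewrite -[LHS]freeg_sumE; apply: eq_bigr => x _.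
by apply/eqP/freeg_eqP => z; rewrite coeffU coeff_fgscale coeffU mul1r.
Qed.

Lemma freemod_eq (K : choiceType) M (f g : {linear freemod R K -> M}) :
  (forall x : K, f << x >> = g << x >>) -> forall u, f u = g u.
Proof.
move=> fg u; rewrite [u]freemod_sumE !linear_sum; apply: eq_bigr => x _.
by rewrite !linearZ fg.
Qed.

Lemma aug_basis M (u : M) : aug M << u >> = u.
Proof. exact: fglift_basis. Qed.

Lemma res_d_basis n M (w : syz n.+1 M) : res_d n M << w >> = val w.
Proof. by rewrite /res_d /= aug_basis. Qed.

Lemma res_exact n M (u : res n M) :
  aug (syz n M) u = 0 -> exists v, u = res_d n M v.
Proof.
move=> u0; have uK : u \in ker (aug (syz n M)) by apply/eqP.
by exists << (Sub u uK : syz n.+1 M) >>; rewrite res_d_basis SubK.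
Qed.

Lemma aug_res_d n M (v : res n.+1 M) : aug (syz n M) (res_d n M v) = 0.
Proof. by apply/eqP; exact: (valP (aug (syz n.+1 M) v)). Qed.

Lemma res_d_eq0 n M (v : res n.+1 M) :
  res_d n M v = 0 -> aug (syz n.+1 M) v = 0.
Proof. by move=> v0; apply/val_inj; rewrite linear0. Qed.

Lemma freemod_lift (K : choiceType) V W (P : K -> V) (d : {linear W -> V}) :
  (forall x, exists w, d w = P x) ->
  exists h : {linear freemod R K -> W}, forall x, d (h << x >>) = P x.
Proof.
move=> dP; have [q qP] := choice dP.
by exists (fglift q : {linear freemod R K -> W}) => x; rewrite fglift_basis.
Qed.

End FreeModules.

(** * Annihilators of Ext and Tor *)

Section FactorThroughFree.
Variable R : comNzRingType.
Implicit Types M N U V W : lmodType R.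

(** Multiplication by [z] on [M] factors as [M -> R -> M], which makes it null-homotopic in positive
    degrees of a free resolution. *)
Definition free_factor (z : R) M : Prop :=
  exists (f : {linear M -> R^o}) (x : M), forall u, z *: u = (f u : R) *: x.

Lemma lin_scale_vec V W (f : {linear V -> R^o}) (w : W) :
  linear (fun v => (f v : R) *: w).
Proof. by move=> c u v; rewrite linearP scalerDl scalerA. Qed.

(** As [d u] is a cycle, [d (z u - h (d u)) = z d u - z d u = 0]. So [z u - h (d u)] lifts through
    the next differential, and it suffices to lift it on basis vectors. *)
Lemma homotopy_extend z M n (h : {linear res n M -> res n.+1 M}) :
  (forall u, aug (syz n M) u = 0 -> z *: u = res_d n M (h u)) ->
  exists h' : {linear res n.+1 M -> res n.+2 M},
    forall u, z *: u = res_d n.+1 M (h' u) + h (res_d n M u).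
Proof.
move=> hP.
have [g gE] : exists g : {linear res n.+1 M -> res n.+1 M},
    forall u, g u = z *: u - h (res_d n M u).
  by exists ((z \*: idfun) \- (h \o res_d n M)).
have [v|h' hP'] := @freemod_lift R _ _ _ (fun u => g << u >>) (res_d n.+1 M).
  have [|w ->] := @res_exact R n.+1 M (g << v >>); last by exists w.
  by apply: res_d_eq0; rewrite gE linearB linearZ -hP ?subrr // aug_res_d.
exists h' => u; rewrite -[_ *: _](subrK (h (res_d n M u))) -gE; congr (_ + _).
exact/esym/(@freemod_eq _ _ _ (res_d n.+1 M \o h') g hP' u).
Qed.

Lemma free_factor_homotopy z M n : free_factor z M ->
  exists h : {linear res n M -> res n.+1 M},
    forall u, aug (syz n M) u = 0 -> z *: u = res_d n M (h u).
Proof.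
move=> [f [x fx]]; elim: n => [|n [h hP]]; last first.
  have [h' hP'] := homotopy_extend hP.
  by exists h' => u u0; rewrite hP' /res_d /= u0 !linear0 addr0.
(* The correction term is the factorization of [z] lifted to the free cover; it makes [g] land in
   the kernel of [aug M] and vanishes on that kernel. *)
have [g gE] : exists g : {linear res 0 M -> res 0 M},
    forall u, g u = z *: u - (f (aug M u) : R) *: (<< x >> : freemod R M).
  by exists ((z \*: idfun)
    \- mkLinear (lin_scale_vec (f \o aug M) (<< x >> : freemod R M))).
have [v|h hP] := @freemod_lift R M _ _ (fun u => g << u >>) (res_d 0 M).
  have [|w ->] := @res_exact R 0 M (g << v >>); last by exists w.
  rewrite gE linearB linearZ [aug M _]aug_basis linearZ.
  by rewrite /= aug_basis fx subrr.
exists h => u u0; transitivity (g u); first by rewrite gE u0 linear0 scale0r subr0.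
exact/esym/(@freemod_eq _ _ _ (res_d 0 M \o h) g hP u).
Qed.

Lemma homology_eq0 U V W (f : {linear U -> V}) (g : {linear V -> W})
    (z : submod (ker g)) :
  \pi_(homology f g) z = 0 <-> exists u, f u = val z.
Proof.
rewrite -[0](linear0 (\pi_(homology f g))).
split=> [/quotmodP|fu]; first by rewrite subr0 => /asboolP.
by apply/quotmodP; rewrite subr0; apply/asboolP.
Qed.

Lemma ann_homology U V W (f : {linear U -> V}) (g : {linear V -> W}) (z : R) :
  ann z (homology f g) <-> forall v, g v = 0 -> exists u, f u = z *: v.
Proof.
split=> [z0 v gv0|zP].
  have vK : v \in ker g by apply/eqP.
  have := z0 (\pi_(homology f g) (Sub v vK)).
  by rewrite -linearZ => /homology_eq0[u fu]; exists u; rewrite fu linearZ.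
elim/quotmod_ind=> v; rewrite -linearZ; apply/homology_eq0.
by rewrite linearZ; apply/zP/eqP/(valP v).
Qed.

Lemma mkHom_subproof M N (f : {linear M -> N}) :
  (f : M -> N) \in mkSubmod (@linear_fun_closed R M N).
Proof. by apply/asboolP; exact: linearP. Qed.

Definition mkHom M N (f : {linear M -> N}) : Defs.Hom M N :=
  exist _ (f : M -> N) (mkHom_subproof f).

Lemma Hom_linear M N (phi : Defs.Hom M N) :
  exists f : {linear M -> N}, forall u, val phi u = f u.
Proof. by have /asboolP L := valP phi; exists (mkLinear L). Qed.

(** With [z = d h] on cycles, [z u - h (d u)] is a cycle, hence a boundary, and a cocycle [phi]
    kills it. So [z phi] is the coboundary of [phi h]. *)
Lemma free_factor_Ext z M N n : (0 < n)%N -> free_factor z M ->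
  ann z (Ext n M N).
Proof.
case: n => // n _ zM; have [h hP] := free_factor_homotopy n zM.
apply/ann_homology => phi phi0; have [f fE] := Hom_linear phi.
have fd u : f (res_d n.+1 M u) = 0.
  by rewrite -fE; have := congr1 (fun g => val g u) phi0.
exists (mkHom (f \o h)); apply/val_inj/funext => u.
rewrite /= -[RHS]/(z *: val phi u) fE; apply/eqP.
rewrite eq_sym -subr_eq0 -linearZ -linearB; apply/eqP.
have [|v ->] := @res_exact R n.+1 M (z *: u - h (res_d n M u)); last exact: fd.
by apply: res_d_eq0; rewrite linearB linearZ -hP ?subrr // aug_res_d.
Qed.

Lemma tens_ind M N (P : tensor M N -> Prop) :
  P 0 -> (forall t t', P t -> P t' -> P (t + t')) ->
  (forall u v, P (tens u v)) -> forall t, P t.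
Proof.
move=> P0 PD Pt; elim/quotmod_ind => w; rewrite [w]freemod_sumE.
elim: (dom w) => [|[u v] s IHs]; first by rewrite big_nil linear0.
rewrite big_cons Defs.pi_add; apply: (PD) => //.
suff -> : \pi_(quotmod (spanm (@bilinear_rel R M N)))
    (coeff (u, v) w *: (<< (u, v) >> : freemod R (M * N)%type)) =
  tens (coeff (u, v) w *: u) v by [].
by rewrite tensZl -[RHS]Defs.pi_scale.
Qed.

Lemma tensor_map_tens M M' N (f : {linear M -> M'}) u (v : N) :
  tensor_map N f (tens u v) = tens (f u) v.
Proof.
exact: etrans (quot_lift_pi (pre_tensor_map_rel f (N:=N)) _) (fglift_basis _ _).
Qed.

(** Tensoring does not preserve kernels, so the identity on cycles is first extended to a homotopy
    [z = d h' + h d] on all of [res 1 M], which survives the tensor product. *)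
Lemma free_factor_Tor z M N : free_factor z M -> ann z (Tor 1 M N).
Proof.
move=> zM; have [h hP] := free_factor_homotopy 0 zM.
have [h' hP'] := homotopy_extend hP.
apply/ann_homology => t dt0; exists (tensor_map N h' t).
have -> : z *: t = tensor_map N (res_d 1 M) (tensor_map N h' t) +
    tensor_map N h (tensor_map N (res_d 0 M) t).
  elim/tens_ind: t {dt0} => [|t t' tE tE'|u v].
  - by rewrite scaler0 !linear0 addr0.
  - by rewrite scalerDr tE tE' !linearD addrACA.
  by rewrite !tensor_map_tens -tensDl -hP' tensZl.
by rewrite dt0 linear0 addr0.
Qed.

Lemma bilinear_lift M N W (b : M -> N -> W) :
  (forall v, linear (b^~ v)) -> (forall u, linear (b u)) ->
  exists f : {linear tensor M N -> W}, forall u v, f (tens u v) = b u v.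
Proof.
move=> bl br; pose g : {linear freemod R (M * N)%type -> W} :=
  fglift (fun w : M * N => b w.1 w.2).
have gE u v : g << (u, v) >> = b u v by rewrite /g fglift_basis.
have bDl u u' v : b (u + u') v = b u v + b u' v.
  exact: (raddfD (mkLinear (bl v))).
have bDr u v v' : b u (v + v') = b u v + b u v'.
  exact: (raddfD (mkLinear (br u))).
have bZl c u v : b (c *: u) v = c *: b u v by exact: (linearZ_LR (mkLinear (bl v))).
have bZr c u v : b u (c *: v) = c *: b u v by exact: (linearZ_LR (mkLinear (br u))).
have g0 w : w \in spanm (@bilinear_rel R M N) -> g w = 0.
  move=> wB; apply/eqP; move: w wB; apply: (@spanm_ind _ _ _ (ker g)).
  move=> _ [u u' v|u v v'|c u v|c u v]; apply/eqP;
    rewrite linearB ?[g (_ - _)]linearB ?[g (_ *: _)]linearZ_LR !gE.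
  - by rewrite bDl addrAC addrK subrr.
  - by rewrite bDr addrAC addrK subrr.
  - by rewrite bZl subrr.
  - by rewrite bZr subrr.
by exists (quot_lift g0) => u v; exact: etrans (quot_lift_pi g0 _) (gE u v).
Qed.

(* An element of ker (aug M) that becomes trivial modulo J gives a cycle in
   Tor_1(M, R/J), on which maps from the syzygy module detect annihilators. *)
Lemma ann_Tor1_syz z M (J : ideal R) W (phi : {linear syz 1 M -> W})
    (w : syz 1 M) :
  ann z (Tor 1 M (quotmod J)) ->
  (forall c v, c \in J -> (c : R) *: phi v = 0) ->
  tens (val w : res 0 M) (\pi_(quotmod J) 1) = 0 -> z *: phi w = 0.
Proof.
move=> /ann_homology zT phiJ w0.
have [|t tP] := zT (tens (<< w >> : res 1 M) (\pi_(quotmod J) 1)).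
  by rewrite tensor_map_tens res_d_basis.
(* Scaling by a representative is well defined because [J] kills the values of [phi]. The induced
   map vanishes on boundaries because [aug] does. *)
pose b (u : res 1 M) (q : quotmod J) : W := (repr q : R) *: phi (aug (syz 1 M) u).
have reprE (q : quotmod J) (c : R) v :
    q = \pi_(quotmod J) (c : R^o) -> (repr q : R) *: phi v = c *: phi v.
  move=> ->; apply/eqP; rewrite -subr_eq0 -scalerBl -oppr_eq0 -scaleNr opprB.
  exact/eqP/phiJ/repr_quotmod.
have [q c u v|u c|f fE] := @bilinear_lift (res 1 M) (quotmod J) W b.
- rewrite /b linearD [aug _ (_ *: _)]linearZ_LR linearD [phi (_ *: _)]linearZ_LR.
  by rewrite scalerDr !scalerA mulrC.
- elim/quotmod_ind=> p; elim/quotmod_ind => q; rewrite /b.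
  rewrite (@reprE _ (c * p + q)) ?linearP //.
  by rewrite (@reprE _ p) // (@reprE _ q) // scalerDl scalerA.
have : f (tensor_map _ (res_d 1 M) t) = 0.
  elim/tens_ind: t {tP} => [|t t' tE tE'|u q]; first by rewrite !linear0.
    by rewrite !linearD tE tE' addr0.
  by rewrite tensor_map_tens fE /b aug_res_d linear0 scaler0.
by rewrite tP linearZ fE /b aug_basis (@reprE _ 1) // scale1r.
Qed.

(** A map on the first syzygy module composed with [aug] is a 1-cocycle; that its [z]-multiple is a
    coboundary means that [z phi] extends to [res 0 M]. *)
Lemma ann_Ext1_syz z M N (phi : {linear syz 1 M -> N}) :
  ann z (Ext 1 M N) ->
  exists psi : {linear res 0 M -> N}, forall w, z *: phi w = psi (val w).
Proof.
move=> /ann_homology zE; have [|psi psiP] := zE (mkHom (phi \o aug (syz 1 M))).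
  apply/val_inj/funext => u /=.
  by rewrite -[RHS]/(0 : N) -[LHS]/(phi (aug (syz 1 M) (res_d 1 M u)))
    aug_res_d linear0.
have [f fE] := Hom_linear psi; exists f => w.
have : val psi (res_d 0 M << w >>) = z *: phi (aug (syz 1 M) << w >>).
  exact: (congr1 (fun g => val g << w >>) psiP).
by rewrite res_d_basis aug_basis fE.
Qed.

End FactorThroughFree.

(** * Ext of the residue ring *)

Section ResidueExt.
Variable R : comNzRingType.
Implicit Types (M N U V W : lmodType R).

Definition mkSub V (S : submodClosed V) v (vS : v \in S) : submod S :=
  exist (fun v => v \in S) v vS.

Lemma submodN V (S : submodClosed V) v : (- v \in S) = (v \in S).
Proof.
by apply/idP/idP => vS; [rewrite -[v]opprK|]; rewrite -scaleN1r rpredZ.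
Qed.

Lemma submodB V (S : submodClosed V) u v : u \in S -> v \in S -> u - v \in S.
Proof. by move=> uS vS; rewrite rpredD ?submodN. Qed.

(* Ext^1(R/m, W) is Hom(m, W) modulo the restrictions of maps R -> W; as it is
   cyclic and killed by m, any two of its elements are proportional. *)
Lemma Ext1_residue_dependent (m : ideal R) W :
  isom (Ext 1 (quotmod m) W) (quotmod m) -> (1 : R^o) \notin m ->
  forall h h' : {linear submod m -> W}, exists c c' rho : R, exists w : W,
    [/\ ((c : R^o) \notin m) || ((c' : R^o) \notin m), (rho - 1 : R^o) \in m &
      forall s, rho *: (c *: h s - c' *: h' s) = (val s : R) *: w].
Proof.
move=> [g [g' gK _]] m1 h h'; pose K := quotmod m.
(* Choosing representatives lifts [aug K] to a map into [R]. It carries syzygies into [m], so maps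
   on [m] pull back to 1-cocycles. *)
pose lam : {linear freemod R K -> R^o} := fglift (fun q : K => repr q : R^o).
have lamE (u : freemod R K) : \pi_K (lam u) = aug K u.
  apply: (@freemod_eq _ _ _ (\pi_K \o lam) (aug K)) => q.
  by rewrite aug_basis /= liftU scale1r reprK.
have lam_m (u : syz 1 K) : lam (val u) \in m.
  rewrite -[lam _]subr0; apply/quotmodP; rewrite lamE linear0.
  exact/eqP/(valP u).
have thL : linear (fun u : syz 1 K => Sub (lam (val u)) (lam_m u) : submod m).
  by move=> c u v; apply/val_inj; rewrite /= !linearP.
pose th : {linear syz 1 K -> submod m} := mkLinear thL.
have phiK (f : {linear submod m -> W}) :
    mkHom (f \o th \o aug (syz 1 K)) \in ker (cores_d 1 K W).
  apply/eqP/val_inj/funext => u.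
  rewrite -[LHS]/(f (th (aug (syz 1 K) (res_d 1 K u)))).
  by rewrite aug_res_d !linear0.
pose xi f : Ext 1 K W := \pi_(Ext 1 K W) (mkSub (phiK f)).
pose p f : R := repr (g (xi f)).
(* Cross multiplication by the coordinates [p h'] and [p h] gives the relation; if both lie in [m],
   then [xi h = 0] and the coefficients 1 and 0 serve. *)
have [c [c' [cm cxi]]] : exists c c' : R,
    ((c : R^o) \notin m) || ((c' : R^o) \notin m) /\ c *: xi h = c' *: xi h'.
  case: (boolP (((p h' : R^o) \notin m) || ((p h : R^o) \notin m))) => [pm|].
    exists (p h'), (p h); split=> //; apply: (can_inj gK).
    have gxi f c : g (c *: xi f) = \pi_K (c * p f : R^o).
      by rewrite linearZ -[g (xi f)]reprK -linearZ.
    by rewrite !gxi mulrC.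
  rewrite negb_or !negbK => /andP[_ hm]; exists 1, 0.
  rewrite m1; split=> //; rewrite scale1r scale0r; apply: (can_inj gK).
  rewrite linear0 -[g (xi h)]reprK -[RHS](linear0 (\pi_K)).
  by apply/quotmodP; rewrite subr0.
have : c *: xi h - c' *: xi h' = 0 by rewrite cxi subrr.
rewrite -!linearZ -linearB => /homology_eq0[psi psiE].
have [f fE] := Hom_linear psi.
(* The representative chosen for the class of 1 need not be 1, whence the factor [rho]. The
   coboundary is evaluated on the syzygies [s <<1>>]. *)
exists c, c', (repr (\pi_K (1 : R^o))), (f << \pi_K (1 : R^o) >>).
split=> //; first by apply/quotmodP; rewrite reprK.
move=> s.
have sK : val s *: (<< \pi_K (1 : R^o) >> : freemod R K) \in ker (aug K).
  apply/eqP; rewrite linearZ aug_basis -linearZ -[RHS](linear0 (\pi_K)).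
  apply/quotmodP; rewrite subr0 /= -[X in X \in _]/(val s * 1) mulr1.
  exact: valP.
pose w : syz 1 K := mkSub sK.
have : val psi (res_d 0 K << w >>) =
    c *: h (th (aug (syz 1 K) << w >>)) - c' *: h' (th (aug (syz 1 K) << w >>)).
  by rewrite -[LHS]/(val (cores_d 0 K W psi) << w >>) psiE.
rewrite res_d_basis aug_basis fE.
have -> : f (val w) = val s *: f << \pi_K (1 : R^o) >> by rewrite linearZ.
move=> ->.
have -> : th w = repr (\pi_K (1 : R^o)) *: s.
  apply/val_inj; rewrite /= linearZ /= liftU scale1r.
  by rewrite -[LHS]/(_ * _) -[RHS]/(_ * _) mulrC.
rewrite [h (_ *: _)]linearZ_LR [h' (_ *: _)]linearZ_LR scalerBr !scalerA.
by rewrite !(mulrC (repr _)).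
Qed.

End ResidueExt.

(** * Spans and linear combinations *)

Section Spans.
Variable R : comNzRingType.
Implicit Types (M N U V W : lmodType R).

Lemma spanm_indP V (X : set V) (P : V -> Prop) :
  P 0 -> (forall u v, P u -> P v -> P (u + v)) ->
  (forall (c : R) u, P u -> P (c *: u)) -> (forall u, X u -> P u) ->
  forall u, u \in spanm X -> P u.
Proof.
move=> P0 PD PZ XP u uX.
have Pc : subsemimod_closed (fun v => `[< P v >]).
  split; first split; first exact/asboolP.
    by move=> v w /asboolP Pv /asboolP Pw; apply/asboolP/PD.
  by move=> c v /asboolP Pv; apply/asboolP/PZ.
by apply/asboolP; apply: (spanm_ind (S := mkSubmod Pc)) uX => v /XP/asboolP.
Qed.

Lemma spanm_rangeP (n : nat) (x : 'I_n -> R) (u : R^o) :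
  u \in spanm (range (x : 'I_n -> R^o)) <-> exists c, u = dot x c.
Proof.
split=> [|[c ->]]; last first.
  by apply: rpred_sum => i _; apply/rpredZ/sub_spanm; exists i.
move: u; apply: spanm_indP.
- by exists 0; rewrite linear0.
- by move=> _ _ [c ->] [c' ->]; exists (c + c'); rewrite linearD.
- by move=> z _ [c ->]; exists (z *: c); rewrite linearZ.
move=> _ [i _ <-]; exists (stdvec R i); rewrite /dot (bigD1 i) //= big1.
  by rewrite ffunE eqxx scale1r addr0.
by move=> j ji; rewrite ffunE (negPf ji) scale0r.
Qed.

Lemma dot_stdvec (n : nat) (x : 'I_n -> R) i : dot x (stdvec R i) = x i.
Proof.
rewrite /dot (bigD1 i) //= big1 => [|j ji]; rewrite ffunE.
  by rewrite eqxx scale1r addr0.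
by rewrite (negPf ji) scale0r.
Qed.

End Spans.

(** * Koszul syzygies on the standard resolution *)

Section KoszulSyzygies.
Variables (R : comNzRingType) (n : nat) (x : 'I_n -> R) (I : ideal R).
Hypothesis xI : generates (x : 'I_n -> R^o) I.

Lemma gen_in i : (x i : R^o) \in I.
Proof. by rewrite xI; apply: sub_spanm; exists i. Qed.

Let xs i : submod I := Sub (x i : R^o) (gen_in i).
Let F := {ffun 'I_n -> R^o}.

(** A comparison map between the two free covers of [I], carrying standard syzygies into [Z1 x]. *)
Lemma resolution_lift :
  exists lam : {linear freemod R (submod I) -> F},
    forall u, dot x (lam u) = val (aug (submod I) u).
Proof.
have [u|lam lamE] := @freemod_lift R (submod I) _ _ val (dot x).
  by have /spanm_rangeP[c ->] : val u \in spanm (range (x : 'I_n -> R^o));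
    [rewrite -xI; exact: valP | exists c].
exists lam; apply: (@freemod_eq _ _ _ (dot x \o lam) (val \o aug _)) => u.
by rewrite /= aug_basis lamE.
Qed.

Let kos i j : F := x i *: stdvec R j - x j *: stdvec R i.

Lemma kos_Z1 i j : kos i j \in Z1 x.
Proof.
apply/eqP; rewrite linearB !linearZ /= !dot_stdvec.
by rewrite scalerN -[x i *: _]/(_ * _) mulrC subrr.
Qed.

Let syz_kos i j : freemod R (submod I) := x i *: << xs j >> - x j *: << xs i >>.

Lemma syz_kosP i j : syz_kos i j \in ker (aug (submod I)).
Proof.
apply/eqP; rewrite linearB !linearZ !aug_basis; apply/val_inj.
by rewrite /= scalerN -[x i *: _]/(_ * _) mulrC subrr.
Qed.

Lemma sub_smulm (V : lmodType R) (S : submodClosed V) (c : R) (v : V) :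
  (c : R^o) \in I -> v \in S -> c *: v \in smulm I S.
Proof. by move=> cI vS; apply: sub_spanm; exists c, v. Qed.

(* The Koszul syzygy on the standard resolution and the one on x agree modulo
   I Z_1, whatever lift is chosen. *)
Lemma lift_kos (lam : {linear freemod R (submod I) -> F}) i j :
  (forall u, dot x (lam u) = val (aug (submod I) u)) ->
  lam (syz_kos i j) - kos i j \in smulm I (Z1 x).
Proof.
move=> lamE; have Zl k : lam << xs k >> - stdvec R k \in Z1 x.
  by apply/eqP; rewrite linearB /= lamE aug_basis dot_stdvec subrr.
have -> : lam (syz_kos i j) - kos i j =
    x i *: (lam << xs j >> - stdvec R j) - x j *: (lam << xs i >> - stdvec R i).
  rewrite linearB [lam (x i *: _)]linearZ_LR [lam (x j *: _)]linearZ_LR.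
  rewrite !scalerBr !opprB addrACA [RHS]addrACA; congr (_ + _); exact: addrC.
by rewrite submodB ?sub_smulm ?gen_in.
Qed.

(** The coefficients of the Koszul syzygy lie in [I], so it becomes trivial modulo [I]; the
    comparison map modulo [I Z_1] has values killed by [I] on syzygies and therefore detects [z]. *)
Lemma ann_Tor1_kos (z : R) :
  ann z (Tor 1 (submod I) (quotmod I)) ->
  forall b, b \in B1 x -> z *: b \in smulm I (Z1 x).
Proof.
move=> zT; have [lam lamE] := resolution_lift.
apply: spanm_indP.
- by rewrite scaler0 rpred0.
- by move=> u v ub vb; rewrite scalerDr rpredD.
- by move=> c u ub; rewrite scalerA mulrC -scalerA rpredZ.
move=> _ [i [j ->]]; pose Q := quotmod (smulm I (Z1 x)).
pose phi : {linear syz 1 (submod I) -> Q} := \pi_Q \o lam \o val.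
have lamZ (w : syz 1 (submod I)) : lam (val w) \in Z1 x.
  by apply/eqP; rewrite /= lamE; have /eqP-> := valP w.
pose w : syz 1 (submod I) := mkSub (syz_kosP i j).
have phiJ (c : R) v : (c : R^o) \in I -> c *: phi v = 0.
  move=> cI; have -> : c *: phi v = \pi_Q (c *: lam (val v)) by rewrite linearZ.
  by rewrite -[RHS](linear0 (\pi_Q)); apply/quotmodP; rewrite subr0 sub_smulm.
have w0 : tens (val w : res 0 (submod I)) (\pi_(quotmod I) (1 : R^o)) = 0.
  have t0 (c : R) k : (c : R^o) \in I ->
      tens (c *: (<< xs k >> : freemod R (submod I))) (\pi_(quotmod I) (1 : R^o))
      = 0.
    (* Writing the zero class as [0 *: 0] lets the scalar 0 be pulled out of the tensor. *)
    move=> cI; have p0 : c *: (\pi_(quotmod I) (1 : R^o) : quotmod I) = 0 *: 0.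
      rewrite scale0r -[LHS]Defs.pi_scale -[RHS](linear0 (\pi_(quotmod I))).
      by apply/quotmodP; rewrite subr0 -[X in X \in _]/(c * 1) mulr1.
    by rewrite tensZl -tensZr p0 tensZr scale0r.
  by rewrite /= /syz_kos -scaleNr tensDl !t0 ?addr0 ?submodN ?gen_in.
have := ann_Tor1_syz zT phiJ w0.
have -> : z *: phi w = \pi_Q (z *: lam (syz_kos i j)) by rewrite linearZ.
rewrite -[RHS](linear0 (\pi_Q)) => /quotmodP; rewrite subr0.
have := lift_kos i j lamE => kl zl.
rewrite -[x i *: _ - _](subKr (lam (syz_kos i j))) scalerBr submodB //.
exact: rpredZ.
Qed.

(** The map [z phi], pulled back to the standard syzygies, extends to the free module, so its value
    at the Koszul syzygy is a combination of [x i] and [x j]. The change of lift lies in [I Z_1],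
    where [phi] takes values in [I]. *)
Lemma ann_Ext1_kos (z : R) : ann z (Ext 1 (submod I) R^o) ->
  forall (phi : {linear submod (Z1 x) -> R^o}) i j (b : submod (Z1 x)),
  val b = x i *: stdvec R j - x j *: stdvec R i -> (z * phi b : R^o) \in I.
Proof.
move=> zE phi i j b bE; have [lam lamE] := resolution_lift.
have lamZ (w : syz 1 (submod I)) : lam (val w) \in Z1 x.
  by apply/eqP; rewrite /= lamE; have /eqP-> := valP w.
have thL : linear (fun w => Sub (lam (val w)) (lamZ w) : submod (Z1 x)).
  by move=> c u v; apply/val_inj; rewrite /= !linearP.
have [psi psiE] := ann_Ext1_syz (phi \o mkLinear thL) zE.
pose w : syz 1 (submod I) := mkSub (syz_kosP i j).
have phiI c (cZ : c \in Z1 x) : c \in smulm I (Z1 x) -> phi (mkSub cZ) \in I.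
  (* The membership proof is part of [P], since span induction runs over [F] while [phi] is defined
     on [Z1 x] only. *)
  pose P (v : F) := exists vZ : v \in Z1 x, phi (mkSub vZ) \in I.
  move=> cI; have [cZ' cI'] : P c; last first.
    by rewrite (_ : mkSub cZ = mkSub cZ') //; apply: val_inj.
  move: c cI {cZ}; apply: spanm_indP.
  - exists (rpred0 _); rewrite (_ : mkSub _ = 0) ?linear0 ?rpred0 //.
    exact: val_inj.
  - move=> u v [uZ uI] [vZ vI]; exists (rpredD uZ vZ).
    rewrite (_ : mkSub _ = mkSub uZ + mkSub vZ); last exact: val_inj.
    by rewrite linearD rpredD.
  - move=> e u [uZ uI]; exists (rpredZ e uZ).
    rewrite (_ : mkSub _ = e *: mkSub uZ); last exact: val_inj.
    by rewrite linearZ rpredZ.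
  move=> _ [e [u [eI uZ ->]]]; exists (rpredZ (e : R) uZ).
  rewrite (_ : mkSub _ = (e : R) *: mkSub uZ); last exact: val_inj.
  by rewrite linearZ /= -[_ *: _]/(_ * _) mulrC; apply: rpredZ.
have psiw : psi (val w) \in I.
  rewrite [val w]/(syz_kos i j) linearB [psi (x i *: _)]linearZ_LR.
  rewrite [psi (x j *: _)]linearZ_LR submodB // -[_ *: _]/(_ * _) mulrC.
    exact: rpredZ (gen_in i).
  exact: rpredZ (gen_in j).
have lI := lift_kos i j lamE.
have bl : phi (mkLinear thL w - b) \in I.
  have -> : mkLinear thL w - b = mkSub (submodB (lamZ w) (valP b)).
    exact: val_inj.
  by apply: phiI; rewrite bE.
rewrite -[b](subKr (mkLinear thL w)) linearB -[z * _]/(z *: (_ - _ : R^o)).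
rewrite scalerBr submodB ?(rpredZ z bl) //.
by rewrite -[phi _]/((phi \o mkLinear thL) w) psiE.
Qed.

End KoszulSyzygies.

(** * Isomorphisms, traces and images *)

Section Isomorphisms.
Variable R : comNzRingType.
Implicit Types (M N U V W : lmodType R).

Lemma isom_sym M N : isom M N -> isom N M.
Proof.
move=> [f [g gK fK]]; have gL : linear g.
  by move=> c u v; apply: (can_inj gK); rewrite linearP !fK.
by exists (mkLinear gL); exists f.
Qed.

Lemma trace_sub M N : isom M N -> {subset trace M <= trace N}.
Proof.
move=> /isom_sym[g [f fK gK]] z; apply: spanm_ind => _ [h [u ->]].
by apply: sub_spanm; exists (h \o g), (f u); rewrite /= gK.
Qed.

Lemma isom_image M V (f : {linear M -> V}) : injective f ->
  exists L : submodClosed V, isom M (submod L) /\ forall u, f u \in L.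
Proof.
move=> f_inj; have Lc : subsemimod_closed (fun v => `[< exists u, f u = v >]).
  split; first split; first by apply/asboolP; exists 0; rewrite linear0.
    move=> _ _ /asboolP[u <-] /asboolP[v <-].
    by apply/asboolP; exists (u + v); rewrite linearD.
  by move=> c _ /asboolP[u <-]; apply/asboolP; exists (c *: u); rewrite linearZ.
have fL u : f u \in mkSubmod Lc by apply/asboolP; exists u.
exists (mkSubmod Lc); split=> //.
have gL : linear (fun u => mkSub (fL u)).
  by move=> c u v; apply/val_inj; rewrite /= linearP.
have /choice[h hP] (v : submod (mkSubmod Lc)) : exists u, f u = val v.
  by have /asboolP := valP v.
exists (mkLinear gL), h => [u|v]; last exact/val_inj/hP.
exact/f_inj/hP.
Qed.

End Isomorphisms.

(** * The exterior square *)

Section ExteriorSquare.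
Variables (R : comNzRingType) (M : lmodType R).

Definition wedge (u v : M) : ext2 M := \pi_(ext2 M) (tens u v).

Lemma wedge_lin (v : M) : linear (wedge^~ v).
Proof.
move=> c u u'; rewrite /wedge tensDl tensZl.
exact: (linearP (\pi_(ext2 M) : tensor M M -> ext2 M)).
Qed.

Lemma wedge_linr (u : M) : linear (wedge u).
Proof.
move=> c v v'; rewrite /wedge tensDr tensZr.
exact: (linearP (\pi_(ext2 M) : tensor M M -> ext2 M)).
Qed.

Lemma wedgeZl c u v : wedge (c *: u) v = c *: wedge u v.
Proof. exact: (linearZ_LR (mkLinear (wedge_lin v))). Qed.

Lemma wedgeZr c u v : wedge u (c *: v) = c *: wedge u v.
Proof. exact: (linearZ_LR (mkLinear (wedge_linr u))). Qed.

Lemma wedge_self u : wedge u u = 0.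
Proof.
rewrite -[RHS](linear0 (\pi_(ext2 M))); apply/quotmodP; rewrite subr0.
by apply: sub_spanm; exists u.
Qed.

Lemma ann_ext2 (z : R) : ann z (ext2 M) <-> forall u v, z *: wedge u v = 0.
Proof.
split=> [z0 u v|z0]; first exact: z0.
elim/quotmod_ind; elim/tens_ind => [|t t' tE tE'|u v]; last exact: z0.
  by rewrite linear0 scaler0.
by rewrite linearD scalerDr tE tE' addr0.
Qed.

Lemma ext2_lift (W : lmodType R) (b : M -> M -> W) :
  (forall v, linear (b^~ v)) -> (forall u, linear (b u)) ->
  (forall u, b u u = 0) ->
  exists f : {linear ext2 M -> W}, forall u v, f (wedge u v) = b u v.
Proof.
move=> bl br b0; have [g gE] := bilinear_lift bl br.
have gS t : t \in spanm [set w : tensor M M | exists u, w = tens u u] -> g t = 0.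
  move=> tS; apply/eqP; move: t tS; apply: (@spanm_ind _ _ _ (ker g)).
  by move=> _ [u ->]; apply/eqP; rewrite gE b0.
exists (quot_lift gS) => u v.
by rewrite -gE; exact: quot_lift_pi gS (tens u v).
Qed.

End ExteriorSquare.

(** * Semigroup rings by coefficients *)

Section Coefficients.
Variables (k : fieldType) (s : nat) (a : 'I_s.+1 -> nat) (fl : flavor).
Local Notation R := (sgring k a fl).
Implicit Types (f g u : R) (n p q : nat).

(** Polynomials and power series are treated together through their coefficients. *)
Definition co : R -> nat -> k :=
  match fl return sgring k a fl -> nat -> k with
  | Graded => fun h n => (val (h : graded_sgring k a))`_n
  | Complete => fun h => val (h : complete_sgring k a)
  end.

Lemma co_iota (f : graded_sgring k a) n : co (iota_sg fl f) n = (val f)`_n.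
Proof. by rewrite /co; case: fl. Qed.

Lemma co_inj f g : co f =1 co g -> f = g.
Proof.
rewrite /co; case: fl f g => f g fg; apply: val_inj; last exact/funext.
exact/polyP.
Qed.

Lemma coD f g n : co (f + g) n = co f n + co g n.
Proof. by rewrite /co; case: fl f g => f g //; rewrite /= coefD. Qed.

Lemma coN f n : co (- f) n = - co f n.
Proof. by rewrite /co; case: fl f => f //; rewrite /= coefN. Qed.

Lemma coB f g n : co (f - g) n = co f n - co g n.
Proof. by rewrite coD coN. Qed.

Lemma co0 n : co 0 n = 0.
Proof. by rewrite -[0](subrr 0) coB subrr. Qed.

Lemma co_sum (J : Type) (r : seq J) (P : pred J) (F : J -> R) n :
  co (\sum_(i <- r | P i) F i) n = \sum_(i <- r | P i) co (F i) n.
Proof. by apply: (big_morph (co^~ n)) => [f g|]; [exact: coD | exact: co0]. Qed.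

Lemma coM f g n : co (f * g) n = \sum_(i < n.+1) co f i * co g (n - i)%N.
Proof. by rewrite /co; case: fl f g => f g //; rewrite /= coefM. Qed.

Lemma co1 n : co 1 n = (n == 0%N)%:R.
Proof. by rewrite /co; case: fl => //=; rewrite coef1. Qed.

Lemma co_sg f n : co f n != 0 -> in_sg a n.
Proof. by rewrite /co; case: fl f => f; have /asboolP fS := valP f; exact: fS. Qed.

(** The graded ring requires finite support; bounding the support of [c] by that of some [f], up to
    a shift by [p], gives one statement for both rings. *)
Lemma co_exists (c : nat -> k) f p :
  (forall n, c n != 0 -> in_sg a n) ->
  (forall n, c n != 0 -> exists2 m, (n <= m + p)%N & co f m != 0) ->
  exists g, forall n, co g n = c n.
Proof.
rewrite /co; case: fl f => f cS cf.
  have gS : (\poly_(i < size (val f) + p) c i) \in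
      mkSubring (sg_poly_closed k a).
    by apply/asboolP => n; rewrite coef_poly; case: ifP => [_ /cS//|]; rewrite eqxx.
  exists (exist (fun h => h \in _) _ gS : graded_sgring k a) => n.
  rewrite /= coef_poly; case: ltnP => // pn.
  apply/esym/eqP/negPn/negP => /cf[m nm]; rewrite nth_default ?eqxx //.
  by rewrite -(leq_add2r p) (leq_trans pn).
have gS : c \in mkSubring (sg_fps_closed k a) by apply/asboolP.
by exists (exist (fun h => h \in _) _ gS : complete_sgring k a).
Qed.

(** The coefficient may be 0, so the zero element is a monomial of every exponent. *)
Definition is_mono u (c : k) p := forall n, co u n = if n == p then c else 0.

(** The monomial [t^p], with default value 0 when [p] is not in the semigroup. *)
Definition tm p : R := iota_sg fl (insubd 0 'X^p).

Lemma tm_mono p : in_sg a p -> is_mono (tm p) 1 p.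
Proof.
move=> pS n; rewrite co_iota insubdK ?coefXn; first by case: eqP.
apply/asboolP=> i; rewrite coefXn.
by case: (eqVneq i p) => [-> _ //|]; rewrite eqxx.
Qed.

Lemma mono_mul u c p f n : is_mono u c p ->
  co (u * f) n = if (p <= n)%N then c * co f (n - p)%N else 0.
Proof.
move=> uE; rewrite coM; case: leqP => [pn|np].
  have pn' : (p < n.+1)%N by [].
  rewrite (bigD1 (Ordinal pn')) //= uE eqxx big1 ?addr0 // => i ip.
  by rewrite uE -[_ == p]/(i == Ordinal pn') (negPf ip) mul0r.
rewrite big1 // => i _; rewrite uE; case: eqP => [ip|]; last by rewrite mul0r.
by have := ltn_ord i; rewrite ip ltnS leqNgt np.
Qed.

Lemma mono_mulD u c p f n : is_mono u c p -> co (u * f) (p + n)%N = c * co f n.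
Proof. by move=> uE; rewrite (mono_mul _ _ uE) leq_addr addKn. Qed.

Lemma mono_reg u c p f g : is_mono u c p -> c != 0 -> u * f = u * g -> f = g.
Proof.
move=> uE c0 fg; apply: co_inj => n; apply: (mulfI c0).
by rewrite -!(mono_mulD _ _ uE) fg.
Qed.

(** For the converse, [idx] assigns each exponent of [f] to one generator that reaches it, and [g i]
    collects the coefficients assigned to [i], divided by [c i]. *)
Lemma span_monoP (n : nat) (u : 'I_n -> R) (c : 'I_n -> k) (p : 'I_n -> nat)
    (D : set 'I_n) (f : R) :
  (forall i, is_mono (u i) (c i) (p i)) -> (forall i, c i != 0) ->
  ((f : R^o) \in spanm ((u : 'I_n -> R^o) @` D)) <->
  (forall m, co f m != 0 ->
    exists i q, [/\ D i, in_sg a q & m = (p i + q)%N]).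
Proof.
move=> uE c0; split.
  move: f; apply: (@spanm_indP R R^o).
  - by move=> m; rewrite co0 eqxx.
  - move=> f g fP gP m; rewrite coD.
    case: (eqVneq (co f m) 0) => [->|fm _]; last exact: fP.
    by rewrite add0r => /gP.
  - move=> z f fP m; rewrite coM => zf.
    have [[j jP]|zf0] := pselect (exists j : 'I_m.+1,
      co z j * co f (m - j)%N != 0); last first.
      case/eqP: zf; apply: big1 => j _; apply/eqP/negPn/negP => jP.
      by apply: zf0; exists j.
    move: jP; rewrite mulf_eq0 negb_or => /andP[/co_sg zj /fP[i [q [Di qS mE]]]].
    exists i, (j + q)%N; split=> //; first exact: in_sgD.
    by rewrite addnCA -mE subnKC // -ltnS.
  - move=> _ [i Di <-] m; rewrite uE; case: (m =P p i) => [->|]; last by rewrite eqxx.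
    by move=> _; exists i, 0%N; rewrite addn0; split=> //; exact: in_sg0.
move=> fP; pose P m i := `[< D i /\ exists2 q, in_sg a q & m = (p i + q)%N >].
pose idx m := [pick i | P m i].
have gP i : exists g, forall q,
    co g q = if idx (p i + q)%N == Some i then (c i)^-1 * co f (p i + q)%N else 0.
  apply: (@co_exists _ f 0) => q.
    case: ifP => [|_]; last by rewrite eqxx.
    rewrite /idx; case: pickP => // j /asboolP[Dj [q' q'S pq]] /eqP[ji].
    by move: pq; rewrite ji => /addnI->.
  case: ifP => [_|_]; last by rewrite eqxx.
  rewrite mulf_eq0 negb_or => /andP[_ fq]; exists (p i + q)%N => //.
  by rewrite addn0 leq_addl.
have [g gE] := choice gP.
have -> : f = \sum_i (if `[< D i >] then u i * g i else 0).
  apply: co_inj => m; rewrite co_sum.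
  have term i : co (if `[< D i >] then u i * g i else 0) m =
      if idx m == Some i then co f m else 0.
    have [im|im] := eqVneq (idx m) (Some i).
      move: (im); rewrite /idx; case: pickP => // j /asboolP[Dj [q' q'S pq]] [ji].
      move: Dj pq; rewrite ji => Di pq; rewrite asboolT // pq (mono_mulD _ _ (uE i)).
      by rewrite gE -pq im eqxx mulrA divff // mul1r.
    case: asboolP => _; last exact: co0.
    rewrite (mono_mul _ _ (uE i)); case: leqP => // pm.
    by rewrite gE subnKC // (negPf im) mulr0.
  rewrite (eq_bigr _ (fun i _ => term i)).
  case im: (idx m) => [i|]; last first.
    rewrite big1 //; apply/eqP/negPn/negP => /fP[i [q [Di qS mE]]].
    move: im; rewrite /idx; case: pickP => // noi _.
    by have /asboolP[] := noi i; split=> //; exists q.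
  rewrite (bigD1 i) //= eqxx big1 ?addr0 // => j ji.
  by case: eqP => // -[ij]; rewrite ij eqxx in ji.
apply: rpred_sum => i _; case: asboolP => Di; last exact: rpred0.
by rewrite mulrC; apply: (@rpredZ R R^o); apply: sub_spanm; exists i.
Qed.

Lemma mono_divP u c p f : is_mono u c p -> c != 0 ->
  (forall n, co f n != 0 -> exists2 q, in_sg a q & n = (p + q)%N) ->
  exists g, f = u * g.
Proof.
move=> uE c0 fP.
have [q|q|g gE] := @co_exists (fun q => c^-1 * co f (p + q)%N) f 0.
- rewrite mulf_eq0 negb_or => /andP[_ /fP[q' q'S /addnI->]] //.
- rewrite mulf_eq0 negb_or => /andP[_ fq]; exists (p + q)%N => //.
  by rewrite addn0 leq_addl.
exists g; apply: co_inj => n; rewrite (mono_mul _ _ uE); case: leqP => pn.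
  by rewrite gE subnKC // mulrA divff // mul1r.
apply/eqP/negPn/negP => /fP[q _ nE].
by move: pn; rewrite nE ltnNge leq_addr.
Qed.

End Coefficients.

(** * Numerical semigroups and their Apery sets *)

Section Semigroup.
Variables (s : nat) (a : 'I_s.+1 -> nat).
Hypothesis a_gt0 : forall i, (0 < a i)%N.
Hypothesis a_incr : forall i j : 'I_s.+1, (i < j)%N -> (a i < a j)%N.
Local Notation e := (a ord0).

Lemma mult_le_gen i : (e <= a i)%N.
Proof.
have [i0|i0] := posnP i; last by apply: ltnW; apply: a_incr.
by rewrite (_ : ord0 = i) //; apply: val_inj.
Qed.

Lemma in_sg_pos n : in_sg a n -> n <> 0%N ->
  exists i q, in_sg a q /\ n = (a i + q)%N.
Proof.
move=> [c ->] n0; have [[i ci]|c0] := pselect (exists i, c i <> 0%N); last first.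
  case: n0; apply: big1 => i _; have [->//|ci] := pselect (c i = 0%N).
  by case: c0; exists i.
exists i, (\sum_j (c j - (j == i)) * a j)%N; split; first by eexists.
rewrite (bigD1 i) //= [in RHS](bigD1 i) //= eqxx addnA; congr (_ + _)%N.
  by case: (c i) ci => // m _; rewrite subn1 mulSn.
by apply: eq_bigr => j /negPf ->; rewrite subn0.
Qed.

Lemma mult_le n : in_sg a n -> n <> 0%N -> (e <= n)%N.
Proof.
move=> nS /(in_sg_pos nS)[i [q [_ ->]]].
exact: leq_trans (mult_le_gen i) (leq_addr _ _).
Qed.

Lemma in_sgM n c : in_sg a n -> in_sg a (c * n).
Proof.
by move=> nS; elim: c => [|c IHc]; [exact: in_sg0 | exact: in_sgD].
Qed.

(* If B and B + g lie in S and h = gcd(g, a_i) = u g - v a_i, then S contains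
   u B + v a_i and u (B + g) = (u B + v a_i) + h. *)
Lemma sg_consecutive (l : seq 'I_s.+1) :
  exists B, in_sg a B /\ in_sg a (B + \big[gcdn/0%N]_(i <- l) a i)%N.
Proof.
elim: l => [|i l [B [BS BgS]]].
  by exists 0%N; rewrite big_nil; split; exact: in_sg0.
rewrite big_cons; set g := \big[_/_]_(_ <- _) _ in BgS *.
have [g0|g_gt0] := posnP g.
  exists 0%N; rewrite g0 gcdn0; split; [exact: in_sg0 | exact: in_sg_gen].
have [u v uv _] := egcdnP (a i) g_gt0.
exists (u * B + v * a i)%N; split.
  by apply: in_sgD; apply: in_sgM => //; exact: in_sg_gen.
by rewrite gcdnC -addnA -uv -mulnDr; exact: in_sgM.
Qed.

Lemma sg_cofinite : \big[gcdn/0%N]_i a i = 1%N ->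
  exists N, forall n, (N <= n)%N -> in_sg a n.
Proof.
move=> a1; have [B [BS]] := sg_consecutive (index_enum _); rewrite a1 => B1S.
exists (B * B)%N => n nB; have [B0|B_gt0] := posnP B.
  by rewrite B0 in B1S; rewrite -[n]muln1; exact: in_sgM.
have rq : (n %% B <= n %/ B)%N.
  by rewrite (leq_trans (ltnW (ltn_pmod n B_gt0))) // leq_divRL.
(* With quotient [q] and remainder [r <= q], this is [q B + r = (q - r) B + r (B + 1)]. *)
have -> : n = ((n %/ B - n %% B) * B + n %% B * (B + 1))%N.
  by rewrite mulnDr muln1 addnA -mulnDl subnK // -divn_eq.
by apply: in_sgD; exact: in_sgM.
Qed.

(** The Apery set of [e] with 0 excluded: each class is represented by its least nonzero element, so
    the class of 0 by [e] itself. *)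
Lemma sg_apery : \big[gcdn/0%N]_i a i = 1%N ->
  exists w : nat -> nat, forall c, [/\ in_sg a (w c), w c <> 0%N &
     forall n, in_sg a n -> n <> 0%N -> (n %% e = c %% e)%N ->
       exists q, n = (w c + q * e)%N].
Proof.
move=> /sg_cofinite[N NS].
suff wP c : exists w, [/\ in_sg a w, w <> 0%N &
    forall n, in_sg a n -> n <> 0%N -> (n %% e = c %% e)%N ->
       exists q, n = (w + q * e)%N].
  by have [w wP'] := choice wP; exists w.
pose P n := `[< in_sg a n >] && ((n != 0%N) && (n %% e == c %% e)%N).
have exP : exists n, P n.
  exists (N.+1 * e + c)%N; rewrite /P modnMDl eqxx andbT.
  have Ne : (N < N.+1 * e)%N by rewrite leq_pmulr.
  rewrite -lt0n (leq_trans _ (leq_addr _ _)) ?muln_gt0 ?a_gt0 // andbT.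
  by apply/asboolP/NS; rewrite (leq_trans (ltnW Ne)) // leq_addr.
have [w /andP[/asboolP wS /andP[/eqP w0 /eqP wc]] wmin] := ex_minnP exP.
exists w; split=> // n nS n0 nc; have wn : (w <= n)%N.
  by apply: wmin; rewrite /P asboolT //= nc eqxx andbT; apply/eqP.
have : (e %| n - w)%N by rewrite -eqn_mod_dvd // nc wc.
by case/dvdnP=> q qE; exists q; rewrite -qE subnKC.
Qed.

End Semigroup.

(** * Minimal multiplicity in terms of exponents *)

Section MinimalMultiplicity.
Variables (k : fieldType) (s : nat) (a : 'I_s.+1 -> nat) (fl : flavor).
Hypothesis a_gt0 : forall i, (0 < a i)%N.
Hypothesis a_incr : forall i j : 'I_s.+1, (i < j)%N -> (a i < a j)%N.
Hypothesis a_gcd : \big[gcdn/0%N]_i a i = 1%N.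
Local Notation e := (a ord0).
Local Notation R := (sgring k a fl).

Lemma in_maxidealP (f : R) : (f : R^o) \in maxideal k a fl <-> co f 0 = 0.
Proof.
have gE i : is_mono (iota_sg fl (tpow k a i)) 1 (a i).
  by move=> n; rewrite co_iota /= coefXn; case: eqP.
have := span_monoP setT f gE (fun=> oner_neq0 k) => fP.
split=> [/fP f0|f0].
  apply/eqP/negPn/negP => /f0[i [q [_ _ iq]]].
  by have := a_gt0 i; rewrite -(leq_add2r q) -iq.
apply/fP => m fm; have [|i [q [qS mE]]] := in_sg_pos (co_sg fm).
  by move=> m0; rewrite m0 f0 eqxx in fm.
by exists i, q.
Qed.

(** If [p + q - e] is not in the semigroup, then [p + q] is the Apery element of its class. As a sum
    of two nonzero elements it is redundant, and the other [e - 1] Apery elements already generate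
    the maximal ideal. *)
Lemma minmult_sum p q : minimal_multiplicity k a fl ->
  in_sg a p -> in_sg a q -> p <> 0%N -> q <> 0%N -> in_sg a (p + q - e)%N.
Proof.
move=> [_ mu_min] pS qS p0 q0; apply: contrapT => pqS.
have [w wP] := sg_apery a_gt0 a_gcd.
have eS : in_sg a e by exact: in_sg_gen.
have pqS' : in_sg a (p + q)%N by exact: in_sgD.
have pq0 : (p + q)%N <> 0%N by case: (p) p0.
have e_gt0 : (0 < e)%N by [].
pose c0 := Ordinal (ltn_pmod (p + q) e_gt0).
have pqE : (p + q)%N = w c0.
  have [_ _ /(_ _ pqS' pq0)[|[|j] jE]] := wP c0; first by rewrite /= modn_mod.
    by rewrite jE addn0.
  case: pqS; rewrite jE mulSn addnCA addKn.
  by apply: in_sgD; [have [] := wP c0 | exact: in_sgM].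
(* Otherwise [q] would be a positive multiple of [e], and [p + q - e] would lie in the semigroup. *)
have pc : (p %% e)%N <> c0.
  move=> /eqP; rewrite /= -[X in (X %% _ == _)%N]addn0 eqn_modDl mod0n eq_sym.
  case/dvdnP => j jE; case: j jE q0 => [->//|j] jE _; case: pqS.
  by rewrite jE mulSn addnCA addKn; apply: in_sgD => //; exact: in_sgM.
have gen (m : nat) : in_sg a m -> m <> 0%N ->
    exists c : 'I_e, c <> c0 /\ exists2 j, in_sg a j & m = (w c + j)%N.
  move=> mS m0; pose c := Ordinal (ltn_pmod m e_gt0).
  have [cc0|cc0] := pselect (c = c0); last first.
    exists c; split=> //; have [_ _ /(_ _ mS m0)[|j jE]] := wP c.
      by rewrite /= modn_mod.
    by exists (j * e)%N => //; exact: in_sgM.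
  have [_ _ /(_ _ mS m0)[|j jE]] := wP c0; first by rewrite -cc0 /= modn_mod.
  (* An element of the class [c0] is [p + q + j e], and [p] is reached from the Apery element of its
     own class [c1]. *)
  pose c1 := Ordinal (ltn_pmod p e_gt0); exists c1; split.
    by move=> /(congr1 val); exact: pc.
  have [_ _ /(_ _ pS p0)[|i iE]] := wP c1; first by rewrite /= modn_mod.
  exists (i * e + q + j * e)%N; last by rewrite jE -pqE {1}iE !addnA.
  by apply: in_sgD; [apply: in_sgD => //|]; exact: in_sgM.
clearbody c0; move: mu_min c0 {pqE pc} gen.
(* With [e = e'.+1], [lift c0] enumerates the [e'] remaining classes. *)
case eE : e => [|e']; first by rewrite eE in e_gt0.
move=> mu_min c0 gen.
pose v (i : 'I_e') : R := tm k a fl (w (fintype.lift c0 i)).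
suff : generates (v : _ -> R^o) (maxideal k a fl).
  by move=> /mu_min; rewrite ltnn.
have vE i : is_mono (v i) 1 (w (fintype.lift c0 i)).
  by apply: tm_mono; have [] := wP (fintype.lift c0 i).
move=> f; apply/idP/idP => [fm|].
  apply/(span_monoP setT f vE (fun=> oner_neq0 k)) => m fm0.
  have [|c [cc0 [j jS mE]]] := gen m (co_sg fm0).
    by move=> m0; move/in_maxidealP: fm fm0; rewrite m0 => ->; rewrite eqxx.
  case: (unliftP c0 c) cc0 mE => [i -> _ mE|//].
  by exists i, j.
move=> /(span_monoP setT f vE (fun=> oner_neq0 k)) fv.
apply/in_maxidealP/eqP/negPn/negP => /fv[i [q' [_ _ wq]]].
by have [_ w0 _] := wP (fintype.lift c0 i); case: (w _) w0 wq.
Qed.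

End MinimalMultiplicity.

(** Linearity of a 2 by 2 determinant in one row, with the error terms that arise when the
    coordinates are linear only modulo an ideal. *)
Lemma det_expand (A : comNzRingType) (z p q x u v x' u' v' : A) :
  x * q - p * x' = z * (u * q - p * u') + (v * q - p * v') +
    (q * (x - (z * u + v)) - p * (x' - (z * u' + v'))).
Proof. ring. Qed.

(** Serves to replace the values at [z] of two multiplications by fractions [t / z] and [t' / z] by
    their numerators. *)
Lemma mul_relation (A : comNzRingType) (z t t' u u' rho b b' : A) :
  z * u = t * z -> z * u' = t' * z ->
  z * (t * (rho * b) - t' * (rho * b')) = z * (rho * (b * u - b' * u')).
Proof.
move=> zu zu'; transitivity (rho * (b * (t * z) - b' * (t' * z))); first by ring.
by rewrite -zu -zu'; ring.
Qed.

(** * Homogeneous ideals in minimal multiplicity *)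

Section MonomialIdeal.
Variables (k : fieldType) (s : nat) (a : 'I_s.+1 -> nat) (fl : flavor).
Hypothesis a_gt0 : forall i, (0 < a i)%N.
Hypothesis a_incr : forall i j : 'I_s.+1, (i < j)%N -> (a i < a j)%N.
Local Notation e := (a ord0).
Local Notation R := (sgring k a fl).
Local Notation S := (in_sg a).
Local Notation m := (maxideal k a fl).

(** The form in which minimal multiplicity enters. *)
Hypothesis sg_sum : forall p q, S p -> S q -> p <> 0%N -> q <> 0%N ->
  S (p + q - e)%N.

Variables (I : ideal R) (r : nat) (X : 'I_r.+1 -> R).
Variables (c : 'I_r.+1 -> k) (d : 'I_r.+1 -> nat).
Hypothesis X_mono : forall i, is_mono (X i) (c i) (d i).
Hypothesis c_neq0 : forall i, c i != 0.
Hypothesis d_incr : forall i j : 'I_r.+1, (i < j)%N -> (d i < d j)%N.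
Hypothesis d_min : forall i j q, S q -> d i = (d j + q)%N -> i = j.
Hypothesis X_gen : generates (X : 'I_r.+1 -> R^o) I.

Variable y : R.
Hypothesis y_mono : is_mono y 1 e.

Lemma e_sg : S e. Proof. exact: in_sg_gen. Qed.

Lemma e_neq0 : e <> 0%N.
Proof. by move=> e0; have := a_gt0 ord0; rewrite e0. Qed.

Lemma X_ord0_reg f g : X ord0 * f = X ord0 * g -> f = g.
Proof. exact: mono_reg (X_mono _) (c_neq0 _). Qed.

Lemma d_sg i : S (d i).
Proof. by apply: (@co_sg _ _ _ _ (X i)); rewrite X_mono eqxx. Qed.

Lemma d_le i : (d ord0 <= d i)%N.
Proof.
have [i0|i0] := posnP i; last by apply/ltnW/d_incr.
by rewrite (_ : i = ord0) //; apply: val_inj.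
Qed.

Definition in_I n := exists i q, S q /\ n = (d i + q)%N.

Lemma in_IP (u : R) :
  (u : R^o) \in I <-> (forall n, co u n != 0 -> in_I n).
Proof.
rewrite X_gen; split.
  move=> /(span_monoP setT u X_mono c_neq0) uI n /uI[i [q [_ qS nE]]].
  by exists i, q.
move=> uI; apply/(span_monoP setT u X_mono c_neq0) => n /uI[i [q [qS nE]]].
by exists i, q.
Qed.

Lemma X_in i : (X i : R^o) \in I.
Proof. exact: gen_in. Qed.

Lemma y_max : (y : R^o) \in m.
Proof.
apply/in_maxidealP => //; rewrite y_mono; case: eqP => // e0.
by case: e_neq0.
Qed.

(* The translation of (9) to exponents. *)
Definition e_colon := forall i, exists2 q, S q & (e + d i = d ord0 + q)%N.

Lemma colonP z : colon (X ord0) I z <->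
  (forall u : R, (u : R^o) \in I -> exists g, z * u = X ord0 * g).
Proof.
split=> zI u uI; last first.
  have [g gE] := zI u uI; rewrite -[z *: u]/(z * u) gE mulrC.
  by apply: (@rpredZ R R^o); exact: sub_spanm.
have : (z * u : R^o) \in spanm [set (X ord0 : R^o)] by exact: zI.
apply: (@spanm_indP R R^o _ (fun v : R^o => exists g, v = X ord0 * g)).
- by exists 0; rewrite mulr0.
- by move=> _ _ [f ->] [g ->]; exists (f + g); rewrite mulrDr.
- by move=> b _ [f ->]; exists (b * f); rewrite mulrCA.
by move=> _ ->; exists 1; rewrite mulr1.
Qed.

Lemma e_colonP : colon (X ord0) I y <-> e_colon.
Proof.
split=> [/colonP yI i|ye].
  have [g gE] := yI _ (X_in i).
  have : co (X ord0 * g) (e + d i) != 0.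
    by rewrite -gE (mono_mulD _ _ y_mono) mul1r X_mono eqxx.
  rewrite (mono_mul _ _ (X_mono _)); case: leqP => // [le0|_]; last by rewrite eqxx.
  rewrite mulf_eq0 negb_or => /andP[_ /co_sg qS].
  by exists (e + d i - d ord0)%N => //; rewrite subnKC.
apply/colonP => u /in_IP uI; apply: mono_divP (X_mono _) (c_neq0 _) _ => n.
rewrite (mono_mul _ _ y_mono); case: leqP => // [le_n|_]; last by rewrite eqxx.
rewrite mul1r => /uI[i [q [qS nE]]]; have [q' q'S qE] := ye i.
exists (q' + q)%N; first exact: in_sgD.
by rewrite addnA -qE -addnA -nE subnKC.
Qed.

(** From [e + d i = d ord0 + q] follows [n + d i = d ord0 + (n + q - e)], and [n + q - e] stays in
    the semigroup for nonzero [n]. *)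
Lemma e_colon_max : e_colon -> forall z, (z : R^o) \in m -> colon (X ord0) I z.
Proof.
move=> ye z /(in_maxidealP a_gt0) z0; apply/colonP => u; rewrite X_gen.
apply: (@spanm_indP R R^o _ (fun u : R^o => exists g, z * u = X ord0 * g)).
- by exists 0; rewrite !mulr0.
- by move=> v w [f fE] [g gE]; exists (f + g); rewrite !mulrDr fE gE.
- by move=> b v [f fE]; exists (b * f); rewrite !(mulrCA _ b) -fE.
move=> _ [i _ <-]; apply: mono_divP (X_mono _) (c_neq0 _) _ => n.
rewrite mulrC (mono_mul _ _ (X_mono _)); case: leqP => // [le_n|_]; last first.
  by rewrite eqxx.
rewrite mulf_eq0 negb_or => /andP[_ zn]; have nS := co_sg zn.
have n0 : (n - d i)%N <> 0%N by move=> n0; rewrite n0 z0 eqxx in zn.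
have [q qS qE] := ye i; have q0 : q <> 0%N.
  by move=> q0; have := d_le i; have := e_neq0; lia.
exists (n - d i + q - e)%N; first exact: sg_sum.
by have := mult_le a_incr nS n0; lia.
Qed.

Lemma bad_generator : ~ e_colon ->
  exists2 j, j != ord0 &
    forall i q, i != j -> S q -> (e + d j)%N <> (d i + q)%N.
Proof.
move=> not_ye; apply: contrapT => noj; apply: not_ye => j.
have [n jn] := ubnP (j : nat); elim: n j jn => // n IHn j jn.
have [->|j0] := eqVneq j ord0; first by exists e; [exact: e_sg | lia].
apply: contrapT => jP; apply: noj; exists j => // i q ij qS eq_ij; apply: jP.
have q0 : q <> 0%N.
  move=> q0; case/eqP: ij; apply: d_min e_sg _; move: eq_ij; rewrite q0; lia.
have eq := mult_le a_incr qS q0.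
have lt_ij : (i < j)%N.
  have [//|/d_incr|/val_inj ijE] := ltngtP i j; first by lia.
  by rewrite ijE eqxx in ij.
have [//|q' q'S q'E] := IHn i; first by lia.
have [i0|i0] := eqVneq i ord0; first by exists q => //; rewrite -i0.
have q'0 : q' <> 0%N.
  by move=> q'0; have := d_le i; have := e_neq0; lia.
exists (q' + q - e)%N; first exact: sg_sum.
by have := mult_le a_incr q'S q'0; lia.
Qed.

(** The map [u |-> z u / X ord0]; linearity follows by cancelling [X ord0]. It sends [X ord0] to
    [z]. *)
Lemma colon_quot z : colon (X ord0) I z ->
  exists f : {linear submod I -> R^o}, forall u, z * val u = X ord0 * f u.
Proof.
move=> /colonP zI.
have /choice[f fE] (u : submod I) : exists g, z * val u = X ord0 * g.
  by have [g gE] := zI _ (valP u); exists g.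
have fL : linear (f : submod I -> R^o).
  move=> b u v; apply: X_ord0_reg; rewrite -fE.
  transitivity (b * (X ord0 * f u) + X ord0 * f v).
    by rewrite -!fE linearP mulrDr; congr (_ + _); exact: mulrCA.
  by rewrite mulrCA -mulrDr.
by exists (mkLinear fL).
Qed.

Let xs i : submod I := mkSub (X_in i).

Lemma colon_free_factor z : colon (X ord0) I z -> free_factor z (submod I).
Proof.
move=> /colon_quot[f fE]; exists f, (xs ord0) => u.
by apply/val_inj; rewrite /= -[RHS]/(_ * _) mulrC -fE.
Qed.

Lemma colon_trace z : colon (X ord0) I z -> z \in trace (submod I).
Proof.
move=> /colon_quot[f fE]; apply: sub_spanm; exists f, (xs ord0).
by apply: X_ord0_reg; rewrite -fE mulrC.
Qed.

(** The ideal is the image of the injective map [u |-> y u / X ord0]. *)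
Lemma e_colon_ideal : e_colon ->
  exists L : ideal R, isom (submod I) (submod L) /\ y \in L.
Proof.
move=> /e_colonP/colon_quot[f fE]; have [|L [IL fL]] := isom_image (f := f).
  move=> u v uv; apply/val_inj; apply: (mono_reg y_mono (oner_neq0 _)).
  by rewrite !fE uv.
exists L; split=> //; suff -> : y = f (xs ord0) by [].
by apply: X_ord0_reg; rewrite -fE mulrC.
Qed.

Lemma ideal_trace (L : ideal R) z :
  isom (submod I) (submod L) -> z \in L -> z \in trace (submod I).
Proof.
move=> [f [g _ fK]] zL; apply: sub_spanm; exists (val \o f), (g (mkSub zL)).
by rewrite /= fK.
Qed.

(** From [z u = f u X ord0] one gets [z (u /\ v) = f u (X ord0 /\ v)]. Each [f (X i)] lies in [m],
    being [z] or of positive order, and a second exchange turns an [m]-multiple of [X ord0 /\ v]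
    into a multiple of [X ord0 /\ X ord0]. *)
Lemma e_colon_ext2 (z : R) : e_colon -> (z : R^o) \in m -> ann z (ext2 (submod I)).
Proof.
move=> ye zm; apply/ann_ext2 => u v.
have step1 (z' : R) v' : (z' : R^o) \in m -> z' *: wedge (xs ord0) v' = 0.
  move=> z'm; have [f fE] := colon_quot (e_colon_max ye z'm).
  rewrite -wedgeZr.
  have -> : z' *: v' = (f v' : R) *: xs ord0.
    by apply/val_inj; rewrite /= -[RHS]/(_ * _) mulrC -fE.
  by rewrite wedgeZr wedge_self scaler0.
have [f fE] := colon_quot (e_colon_max ye zm).
have -> : z *: wedge u v = (f u : R) *: wedge (xs ord0) v.
  rewrite -!wedgeZl; congr wedge.
  by apply/val_inj; rewrite /= -[RHS]/(_ * _) mulrC -fE.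
case: u => u uI; pose P (u : R^o) := exists uI : u \in I,
  (f (mkSub uI) : R) *: wedge (xs ord0) v = 0.
have [uI'] : P u.
  move: (uI); rewrite X_gen; apply: spanm_indP.
  - exists (rpred0 _); rewrite (_ : mkSub _ = 0) ?linear0 ?scale0r //.
    exact: val_inj.
  - move=> {uI}u u' [uI uE] [u'I u'E]; exists (rpredD uI u'I).
    rewrite (_ : mkSub _ = mkSub uI + mkSub u'I); last exact: val_inj.
    by rewrite linearD scalerDl uE u'E addr0.
  - move=> b {uI}u [uI uE]; exists (rpredZ b uI).
    rewrite (_ : mkSub _ = b *: mkSub uI); last exact: val_inj.
    by rewrite linearZ -scalerA uE scaler0.
  move=> _ [i _ <-]; exists (X_in i).
  have [->|i0] := eqVneq i ord0.
    have -> : f (xs ord0) = z by apply: X_ord0_reg; rewrite -fE mulrC.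
    exact: step1.
  apply: step1; apply/in_maxidealP => //; apply: (mulfI (c_neq0 ord0)).
  rewrite -(mono_mulD _ _ (X_mono ord0)) -fE mulrC (mono_mul _ _ (X_mono i)).
  rewrite mulr0 addn0 leqNgt d_incr // lt0n.
  by apply: contra i0 => /eqP i0; apply/eqP/val_inj.
by rewrite (_ : mkSub uI' = exist _ u uI) //; apply: val_inj.
Qed.

(** Dividing [z X i] and [z X j] by [X ord0] writes a multiple of a Koszul boundary as [X ord0]
    times a cycle. *)
Lemma e_colon_kos : e_colon -> {subset smulm m (B1 X) <= smulm I (Z1 X)}.
Proof.
move=> ye; apply: spanm_ind => _ [z [b [zm bB ->]]].
move: b bB; apply: spanm_indP.
- by rewrite scaler0 rpred0.
- by move=> u v ub vb; rewrite scalerDr rpredD.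
- by move=> b u ub; rewrite scalerA mulrC -scalerA rpredZ.
move=> _ [i [j ->]]; have [f fE] := colon_quot (e_colon_max ye zm).
have -> : (z : R) *: (X i *: stdvec R j - X j *: stdvec R i) =
    X ord0 *: (f (xs i) *: stdvec R j - f (xs j) *: stdvec R i).
  by rewrite !scalerBr !scalerA -!fE.
apply: sub_smulm; first exact: X_in.
apply/eqP; rewrite linearB /= ![dot X (_ *: _)]linearZ_LR /= !dot_stdvec.
apply/eqP; rewrite subr_eq0; apply/eqP/X_ord0_reg.
rewrite -[_ *: _]/(_ * _) -[f (xs j) *: _]/(_ * _) !mulrA.
by rewrite -[X ord0 * _]fE -[X ord0 * f (xs j)]fE /= -!mulrA (mulrC (X i)).
Qed.

(** When no other generator reaches degree [n], the coefficient of [t^n] in the relation comes from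
    the [i]-th term alone. *)
Lemma Z1_coef (z : {ffun 'I_r.+1 -> R^o}) n i : z \in Z1 X ->
  (forall l q, l != i -> S q -> n <> (d l + q)%N) -> (d i <= n)%N ->
  co (z i : R) (n - d i) = 0.
Proof.
move=> /eqP zX nP din; have : co (dot X z) n = 0 by rewrite zX co0.
rewrite /dot co_sum (bigD1 i) //= big1 => [|l li].
  rewrite addr0 -[_ *: _]/(_ * _) mulrC (mono_mul _ _ (X_mono i)) din.
  by move=> /eqP; rewrite mulf_eq0 (negPf (c_neq0 i)) => /eqP.
rewrite -[_ *: _]/(_ * _) mulrC (mono_mul _ _ (X_mono l)); case: leqP => // dln.
apply/eqP/negPn/negP; rewrite mulf_eq0 negb_or => /andP[_ /co_sg qS].
by apply: (nP _ _ li qS); rewrite subnKC.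
Qed.

Lemma Z1_max (z : {ffun 'I_r.+1 -> R^o}) i : z \in Z1 X -> co (z i : R) 0 = 0.
Proof.
move=> zZ; rewrite -(subnn (d i)); apply: (Z1_coef zZ) => // l q li qS dE.
by move: li; rewrite (d_min qS dE) eqxx.
Qed.

(** * The obstruction from a bad generator *)

Section BadGenerator.
Variable j : 'I_r.+1.
Hypothesis j0 : j != ord0.
Hypothesis bad : forall i q, i != j -> S q -> (e + d j)%N <> (d i + q)%N.

Lemma Z1_bad (z : {ffun 'I_r.+1 -> R^o}) n : z \in Z1 X ->
  co (z j : R) n != 0 -> (e < n)%N.
Proof.
move=> zZ zn; have nS := co_sg zn.
have n0 : n <> 0%N by move=> n0; rewrite n0 Z1_max ?eqxx in zn.
have := mult_le a_incr nS n0; rewrite leq_eqVlt => /orP[/eqP ne|//].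
by move: zn; rewrite -ne -[X in co _ X](addnK (d j)) (Z1_coef zZ) ?eqxx // leq_addl.
Qed.

Lemma bad_in_I n : in_I n -> (d ord0 <= n)%N.
Proof. by move=> [i [q [_ ->]]]; rewrite (leq_trans (d_le i)) // leq_addr. Qed.

(** Elements of [I] start in degree [d ord0] and the [j]-th coordinates of cycles strictly above
    [e], so their products miss the degree [e + d ord0] of [y X ord0]. *)
Lemma smul_Z1_coef (w : {ffun 'I_r.+1 -> R^o}) n : w \in smulm I (Z1 X) ->
  (n <= e + d ord0)%N -> co (w j : R) n = 0.
Proof.
move=> wZ; move: w wZ n; apply: spanm_indP.
- by move=> n _; rewrite ffunE co0.
- by move=> u v uE vE n ne; rewrite ffunE coD uE // vE // addr0.
- move=> b u uE n ne; rewrite ffunE -[_ *: _]/(_ * _) coM big1 // => i _.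
  by rewrite uE ?mulr0 // (leq_trans (leq_subr _ _)).
move=> _ [u [z [uI zZ ->]]] n ne; rewrite ffunE -[_ *: _]/(_ * _) coM big1 // => i _.
apply/eqP/negPn/negP; rewrite mulf_eq0 negb_or => /andP[ui /(Z1_bad zZ)].
by have /bad_in_I := (in_IP u).1 uI _ ui; lia.
Qed.

Lemma kos_coord : (X ord0 *: stdvec R j - X j *: stdvec R ord0) j = X ord0.
Proof.
rewrite !ffunE eqxx (negPf j0) scaler0 subr0.
by rewrite -[_ *: _]/(_ * _) mulr1.
Qed.

Lemma bad_kos :
  ~ (y *: (X ord0 *: stdvec R j - X j *: stdvec R ord0) \in smulm I (Z1 X)).
Proof.
move=> /smul_Z1_coef/(_ (leqnn _)); rewrite ffunE kos_coord.
rewrite -[_ *: _]/(_ * _) (mono_mulD _ _ y_mono) mul1r X_mono eqxx.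
by apply/eqP.
Qed.

(** Here [P = n + e + d ord0] with [n] the Frobenius number, a shift that allows [n = -1]. The map
    is [z |-> t^(n - e) z_j], with values in [R] because [z_j] has exponents above [e]. At the
    Koszul cycle, [y] times its value has exponent [n + d ord0 = P - e], which is not one of [I]. *)
Lemma bad_Ext1 P : (forall n, (P < n + e + d ord0)%N -> S n) ->
  (e + d ord0 <= P.+1)%N -> (forall q, in_I q -> P <> (e + q)%N) ->
  ~ ann y (Ext 1 (submod I) R^o).
Proof.
move=> P_sg P_ge P_in yE; pose T := tm k a fl (e + e + d ord0).
have PS : S P by apply: P_sg; have := a_gt0 ord0; lia.
have TE : is_mono T 1 (e + e + d ord0).
  by apply: tm_mono; apply: in_sgD (d_sg _); exact: in_sgD e_sg e_sg.
have PE : is_mono (tm k a fl P) 1 P by exact: tm_mono.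
have /choice[phi phiE] (z : submod (Z1 X)) :
    exists g, tm k a fl P * (val z) j = T * g.
  apply: mono_divP TE (oner_neq0 _) _ => n; rewrite (mono_mul _ _ PE).
  case: leqP => [Pn|_]; last by rewrite eqxx.
  rewrite mul1r => zn; have en := Z1_bad (valP z) zn.
  exists (n - (e + e + d ord0))%N; last by lia.
  by apply: P_sg; lia.
have T_reg := mono_reg TE (oner_neq0 _).
have phiL : linear (phi : submod (Z1 X) -> R^o).
  move=> b u v; apply: T_reg; rewrite -phiE.
  transitivity (b * (T * phi u) + T * phi v); last by rewrite mulrCA -mulrDr.
  rewrite -!phiE /= !ffunE mulrDr; congr (_ + _); exact: mulrCA.
pose b := mkSub (kos_Z1 X ord0 j).
have := @ann_Ext1_kos _ _ _ _ X_gen _ yE (mkLinear phiL) ord0 j b erefl.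
move=> /in_IP/= yI; have := congr1 (fun f : R => co f (P + d ord0)%N) (phiE b).
rewrite [(val b) j]kos_coord (mono_mulD _ _ PE) X_mono eqxx mul1r.
rewrite (mono_mul _ _ TE); case: leqP => [le_P|_]; last first.
  by move/eqP; rewrite (negPf (c_neq0 _)).
rewrite mul1r => cE; apply: (P_in (P - e)%N); last by lia.
apply: yI; rewrite (_ : P - e = e + (P + d ord0 - (e + e + d ord0)))%N; last by lia.
by rewrite (mono_mulD _ _ y_mono) mul1r -cE.
Qed.

End BadGenerator.

Lemma kos_e_colon :
  (forall b, b \in B1 X -> y *: b \in smulm I (Z1 X)) -> e_colon.
Proof.
move=> yB; apply: contrapT => /bad_generator[j j0 bad].
apply: (bad_kos j0 bad); apply/yB/sub_spanm.
by exists ord0, j.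
Qed.

Lemma Tor1_e_colon : ann y (Tor 1 (submod I) (quotmod I)) -> e_colon.
Proof. by move=> yT; apply: kos_e_colon; exact: ann_Tor1_kos. Qed.

(* Modulo the monomials other than 1 and y, R is k[y]/(y^2). *)
Lemma co_mul_e (f g : R) : co (f * g) e = co f 0 * co g e + co f e * co g 0.
Proof.
rewrite coM big_ord_recl subn0; congr (_ + _).
have e_gt0 : (e.-1 < e)%N by rewrite prednK.
rewrite (bigD1 (Ordinal e_gt0)) //= /bump /= add1n prednK // subnn.
rewrite big1 ?addr0 // => i ie; apply/eqP/negPn/negP.
rewrite mulf_eq0 negb_or => /andP[/co_sg iS _].
have := mult_le a_incr iS (PeanoNat.Nat.neq_succ_0 _); rewrite /bump /= => ei.
case/eqP: ie; apply: val_inj => /=.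
have := ltn_ord i; lia.
Qed.

Lemma co_mul_0 (f g : R) : co (f * g) 0 = co f 0 * co g 0.
Proof. by rewrite coM big_ord1. Qed.

Lemma dual_closed : subsemimod_closed (fun f : R^o =>
  (co (f : R) 0 == 0) && (co (f : R) e == 0)).
Proof.
split; first split.
- by apply/andP; split; apply/eqP; exact: co0.
- move=> f g /andP[/eqP f0 /eqP fe] /andP[/eqP g0 /eqP ge].
  by apply/andP; split; apply/eqP;
    rewrite [LHS]coD ?f0 ?fe ?g0 ?ge addr0.
- move=> b f /andP[/eqP f0 /eqP fe]; apply/andP; split; apply/eqP.
    by rewrite [LHS]co_mul_0 f0 mulr0.
  by rewrite [LHS]co_mul_e f0 fe !mulr0 addr0.
Qed.

(** The kernel of the truncation [R -> k[y]/(y^2)]. *)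
Definition dual_ideal : ideal R := mkSubmod dual_closed.

(** A map [I -> R] is multiplication by [g / X ord0]. If a value had a term in degree 0 or [e], some
    exponent [i] of [g] would be at most [e] and carry every [d t] into [d ord0 + S]; then [i = e]
    is the exponent condition itself. *)
Lemma trace_e_colon : y \in trace (submod I) -> e_colon.
Proof.
move=> y_tr; apply: contrapT => not_ye.
suff : (y : R^o) \in dual_ideal.
  by move=> /andP[_]; rewrite y_mono eqxx oner_eq0.
move: (y : R^o) y_tr; apply: spanm_ind => _ [f [u ->]].
have fZ (b : R) v : f (b *: v) = b * (f v : R) by exact: (linearZ_LR f b v).
have fuE v : X ord0 * (f v : R) = (f (mkSub (X_in ord0)) : R) * val v.
  rewrite -fZ; have -> : X ord0 *: v = (val v : R) *: mkSub (X_in ord0).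
    by apply/val_inj; rewrite /= -[LHS]/(_ * _) mulrC.
  by rewrite fZ mulrC.
set g : R := f (mkSub (X_in ord0)) in fuE.
suff fu n : (n = 0%N \/ n = e) -> co (f u : R) n = 0.
  by apply/andP; rewrite !fu ?eqxx; [|right|left].
move=> n0e; apply/eqP/negPn/negP => fun0.
have : co (g * val u) (d ord0 + n) != 0.
  by rewrite -fuE (mono_mulD _ _ (X_mono _)) mulf_neq0.
rewrite coM => gu.
have [[i iP]|no_i] := pselect (exists i : 'I_(d ord0 + n).+1,
    co g i * co (val u : R) (d ord0 + n - i)%N != 0); last first.
  case/eqP: gu; apply: big1 => i _; apply/eqP/negPn/negP => iP.
  by apply: no_i; exists i.
move: iP; rewrite mulf_eq0 negb_or => /andP[gi /((in_IP _).1 (valP u))].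
move=> [l [q [qS lq]]]; have ile : (i <= d ord0 + n)%N by rewrite -ltnS.
have tS t : (d ord0 <= i + d t)%N /\ S (i + d t - d ord0)%N.
  have : co (X ord0 * f (mkSub (X_in t))) (d t + i) != 0.
    by rewrite fuE mulrC (mono_mulD _ _ (X_mono _)) mulf_neq0.
  rewrite (mono_mul _ _ (X_mono _)) addnC; case: leqP => [le0|]; last by rewrite eqxx.
  by rewrite mulf_eq0 negb_or => /andP[_ /co_sg].
(* If [i = 0], minimality leaves [ord0] as the only generator, and [e_colon] holds trivially. *)
have i0 : nat_of_ord i = 0%N -> False.
  move=> i0; apply: not_ye => t; have [] := tS t; rewrite i0 add0n => le0 S0.
  have -> : t = ord0 by apply: d_min S0 _; rewrite subnKC.
  by exists e; [exact: e_sg | lia].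
have [iS_ge iS] := tS ord0; have [lS_ge lS] := tS l.
have i_sg : S i by move: iS; rewrite addnK.
have ie := mult_le a_incr i_sg i0; have := d_le l => dl.
case: n0e => n0e; first by apply: i0; lia.
apply: not_ye => t; have [t_ge t_sg] := tS t.
exists (i + d t - d ord0)%N => //; lia.
Qed.

(** A coordinate of [I] with values in [k[y]/(y^2)], represented by elements of [R]; its linearity
    will hold only modulo [dual_ideal]. *)
Lemma dual_coord_exists i : exists al : submod I -> R,
  forall u, co (al u) 0 = co (val u : R) (d i) /\
            co (al u) e = co (val u : R) (d i + e).
Proof.
suff /choice[al alP] (u : submod I) : exists g : R,
    co g 0 = co (val u : R) (d i) /\ co g e = co (val u : R) (d i + e).
  by exists al.
have [n|n|g gE] := @co_exists k s a fl (fun n => if n == 0%N then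
    co (val u : R) (d i) else if n == e then co (val u : R) (d i + e) else 0) 1 e.
- case: (n =P 0%N) => [-> _|_]; first exact: in_sg0.
  by case: (n =P e) => [-> _|_]; [exact: e_sg | rewrite eqxx].
- move=> hn; exists 0%N; last by rewrite co1 oner_eq0.
  by move: hn; case: (n =P 0%N) => [->|_] //; case: (n =P e) => [->|_] //;
    rewrite eqxx.
exists g; rewrite !gE !eqxx; split=> //.
by case: (e =P 0%N) => [/e_neq0|].
Qed.

Lemma co_mul_d i z (u : R) : (u : R^o) \in I ->
  co (z * u) (d i) = co z 0 * co u (d i).
Proof.
move=> /in_IP uI; rewrite coM big_ord_recl subn0 big1 ?addr0 // => n _.
apply/eqP/negPn/negP; rewrite mulf_eq0 negb_or => /andP[/co_sg nS].
move=> /uI[l [q [qS lq]]]; have dlq : d i = (d l + (q + bump 0 n))%N.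
  by rewrite addnA -lq subnK // -ltnS.
have li := d_min (in_sgD qS nS) dlq; move: dlq; rewrite -li /bump; lia.
Qed.

(** As no other generator reaches degree [d i + e], only the terms of [z] in degrees 0 and [e]
    contribute. *)
Lemma co_mul_de i z (u : R) : (u : R^o) \in I ->
  (forall l q, l != i -> S q -> (d i + e)%N <> (d l + q)%N) ->
  co (z * u) (d i + e) = co z 0 * co u (d i + e) + co z e * co u (d i).
Proof.
move=> /in_IP uI iP; rewrite coM big_ord_recl subn0; congr (_ + _).
have e_lt : (e.-1 < d i + e)%N by have := a_gt0 ord0; lia.
rewrite (bigD1 (Ordinal e_lt)) //= /bump /= add1n prednK // addnK.
rewrite big1 ?addr0 // => n ne; apply/eqP/negPn/negP.
rewrite mulf_eq0 negb_or => /andP[/co_sg nS /uI[l [q [qS lq]]]].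
have nlt := ltn_ord n; move: nS lq; rewrite /bump /= add1n => nS lq.
have dlq : (d i + e = d l + (q + n.+1))%N by lia.
have [li|li] := eqVneq l i; last exact: (iP _ _ li (in_sgD qS nS) dlq).
have := mult_le a_incr nS (PeanoNat.Nat.neq_succ_0 _) => en.
by case/eqP: ne; apply: val_inj => /=; rewrite li in dlq; lia.
Qed.

Lemma dual_coord_lin i (al : submod I -> R) :
  (forall u, co (al u) 0 = co (val u : R) (d i) /\
             co (al u) e = co (val u : R) (d i + e)) ->
  (forall l q, l != i -> S q -> (d i + e)%N <> (d l + q)%N) ->
  forall (b : R) u v,
    ((al (b *: u + v) - (b * al u + al v) : R) : R^o) \in dual_ideal.
Proof.
move=> alP iP b u v; have [a0 ae] := alP (b *: u + v).
have [u0 ue] := alP u; have [v0 ve] := alP v.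
have vE n : co (val (b *: u + v) : R) n = co (b * val u) n + co (val v : R) n.
  by rewrite -coD linearP.
apply/andP; split; apply/eqP; rewrite [LHS]coB coD.
  by rewrite a0 vE (co_mul_d _ _ (valP u)) co_mul_0 u0 v0 subrr.
by rewrite ae vE (co_mul_de _ (valP u) iP) co_mul_e u0 ue ve subrr.
Qed.

(** The determinant of the coordinates at [ord0] and [j] is alternating modulo [dual_ideal]. At the
    two generators its constant term is [c ord0 * c j], so its product with [y] is nonzero. *)
Lemma ext2_e_colon : ann y (ext2 (submod I)) -> e_colon.
Proof.
move=> /ann_ext2 y_ext; apply: contrapT => /bad_generator[j j0 bad].
have [al alP] := dual_coord_exists ord0; have [be beP] := dual_coord_exists j.
have al_lin := dual_coord_lin alP; have be_lin := dual_coord_lin beP.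
have {}al_lin : forall (b : R) u v,
    ((al (b *: u + v) - (b * al u + al v) : R) : R^o) \in dual_ideal.
  (* Since [d l > d ord0], the exponent [q] is below [e], hence 0; then [d l = d ord0 + e]
     contradicts minimality. *)
  apply: al_lin => l q l0 qS dE.
  have l_gt0 : (d ord0 < d l)%N.
    by apply: d_incr; rewrite lt0n; apply: contra l0 => /eqP l0; apply/eqP/val_inj.
  have [q0|q0] := pselect (q = 0%N); last by have := mult_le a_incr qS q0; lia.
  move: l0; rewrite (@d_min l ord0 e) ?eqxx //; [exact: e_sg | lia].
have {}be_lin : forall (b : R) u v,
    ((be (b *: u + v) - (b * be u + be v) : R) : R^o) \in dual_ideal.
  by apply: be_lin => l q li qS; rewrite addnC; exact: bad.
pose Q := quotmod dual_ideal.
pose b u v : Q := \pi_Q ((al u * be v - al v * be u : R) : R^o).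
have bE (z w w' x1 x2 x3 : R) (t t' : R) :
    x1 = z * x2 + x3 + (t * w - t' * w') ->
    (w : R^o) \in dual_ideal -> (w' : R^o) \in dual_ideal ->
    \pi_Q (x1 : R^o) = z *: \pi_Q (x2 : R^o) + \pi_Q (x3 : R^o).
  move=> -> wD wD'; rewrite -linearP; apply/quotmodP.
  have -> : (z * x2 + x3 + (t * w - t' * w') : R^o) - (z *: (x2 : R^o) + x3) =
      t *: (w : R^o) - t' *: (w' : R^o).
    by rewrite [LHS]addrC addKr.
  by rewrite submodB // rpredZ.
have [v z u u'|u z v v'|u|f fE] := @ext2_lift _ (submod I) Q b.
- exact: bE (det_expand _ _ _ _ _ _ _ _ _) (al_lin z u u') (be_lin z u u').
- rewrite /b ![al u * _]mulrC !(mulrC _ (be u)).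
  exact: bE (det_expand _ _ _ _ _ _ _ _ _) (be_lin z v v') (al_lin z v v').
- by rewrite /b mulrC subrr linear0.
have := congr1 f (y_ext (xs ord0) (xs j)).
rewrite linear0 linearZ fE /b -[LHS]linearZ -[RHS](linear0 (\pi_Q)).
move=> /quotmodP; rewrite subr0 => /andP[_ /eqP].
have -> : y *: (al (xs ord0) * be (xs j) - al (xs j) * be (xs ord0) : R^o) =
  y * (al (xs ord0) * be (xs j) - al (xs j) * be (xs ord0)) by [].
rewrite co_mul_e [co y 0]y_mono.
have -> : (0 == e)%N = false by apply/eqP => e0; case: e_neq0.
rewrite mul0r add0r y_mono eqxx mul1r coB !co_mul_0.
have [-> _] := alP (xs ord0); have [-> _] := alP (xs j).
have [-> _] := beP (xs j); rewrite /= !X_mono !eqxx.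
have -> : (d ord0 == d j) = false.
  apply/eqP => d0; case/eqP: j0; apply: (d_min (in_sg0 a)); lia.
by rewrite mul0r subr0 => /eqP; rewrite mulf_eq0 !(negPf (c_neq0 _)).
Qed.

(** * The canonical hypothesis and the Frobenius number *)

Section Canonical.
Variable omega : lmodType R.
Hypothesis omega_can : canonical_module m omega.
Hypothesis I_can : isom (submod I) omega.
Hypothesis a_gcd : \big[gcdn/0%N]_i a i = 1%N.

(** The shift by [e] admits negative values of [p - e]. *)
Definition outside p := forall q, in_I q -> p <> (e + q)%N.

(* t^(p - e) lies outside I but is sent into I by the maximal ideal. *)
Definition socle_exp p := outside p /\
  forall q, S q -> q <> 0%N -> exists2 q', in_I q' & (p + q)%N = (e + q')%N.

Lemma in_I_sg n : in_I n -> S n.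
Proof. by move=> [i [q [qS ->]]]; exact: in_sgD (d_sg i) qS. Qed.

(** Multiplication by [t^(p - e)] from [m] to [I]. Since [p + e] is [e] plus an exponent of [I], the
    power [t^p] is in [R], and the map is defined by division by [y]. *)
Lemma socle_exp_hom p : socle_exp p ->
  exists h : {linear submod m -> submod I},
    forall f, y * val (h f) = tm k a fl p * val f.
Proof.
move=> [_ p_socle]; have pS : S p.
  have [q qI /eqP] := p_socle _ e_sg e_neq0.
  by rewrite addnC eqn_add2l => /eqP ->; exact: in_I_sg.
have y_reg := mono_reg y_mono (oner_neq0 _); have pE := tm_mono k fl pS.
have /choice[h hE] (f : submod m) : exists v : submod I,
    y * val v = tm k a fl p * val f.
  have supp n : co (tm k a fl p * val f) n != 0 ->
      exists2 q, in_I q & n = (e + q)%N.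
    rewrite (mono_mul _ _ pE) mul1r; case: leqP => [pn|]; last by rewrite eqxx.
    move=> fn; have [|q qI qE] := p_socle _ (co_sg fn).
      move=> n0; move: fn; rewrite n0 (in_maxidealP a_gt0 _).1 ?eqxx //.
      exact: valP.
    by exists q; rewrite // -qE subnKC.
  have [n /supp[q /in_I_sg qS nE]|g gE] := mono_divP y_mono (oner_neq0 _) (f := tm k a fl p * val f).
    by exists q.
  have gI : (g : R^o) \in I.
    apply/in_IP => n gn; have [|q qI /eqP] := supp (e + n)%N.
      by rewrite gE (mono_mulD _ _ y_mono) mul1r.
    by rewrite eqn_add2l => /eqP ->.
  by exists (mkSub gI).
have hL : linear h.
  move=> b u v; apply/val_inj/y_reg; rewrite hE.
  transitivity (b * (y * val (h u)) + y * val (h v)); last first.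
    by rewrite linearP mulrCA -mulrDr.
  by rewrite !hE linearP mulrDr; congr (_ + _); exact: mulrCA.
by exists (mkLinear hL) => f; rewrite -hE.
Qed.

(** Compare coefficients of [t^p]. The second term contributes none, since a nonzero [p - p'] in the
    semigroup would contradict [outside p]; the right-hand side contributes none for the same
    reason, and [co g 0] remains. *)
Lemma socle_exp_separated p p' (g g' v : R) :
  socle_exp p -> socle_exp p' -> p <> p' -> co g 0 != 0 -> (v : R^o) \in I ->
  tm k a fl p * g - tm k a fl p' * g' <> y * v.
Proof.
move=> pP p'P pp' g0 /in_IP vI eq_gg'.
have [p_out p_in] := pP; have [_ p'_in] := p'P.
have sg n : socle_exp n -> S n.
  move=> [_ n_in]; have [q qI /eqP] := n_in _ e_sg e_neq0.
  by rewrite addnC eqn_add2l => /eqP ->; exact: in_I_sg.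
have pE : is_mono (tm k a fl p) 1 p by apply/tm_mono/sg.
have pE' : is_mono (tm k a fl p') 1 p' by apply/tm_mono/sg.
have : co (y * v) p = co g 0.
  rewrite -eq_gg' coB (mono_mul _ _ pE) (mono_mul _ _ pE') leqnn subnn !mul1r.
  rewrite -[RHS]subr0; congr (_ - _); case: leqP => // lepp.
  apply/eqP/negPn/negP => /co_sg ppS; have [|q qI] := p'_in _ ppS; first by lia.
  by rewrite subnKC //; exact: p_out.
rewrite (mono_mul _ _ y_mono); case: leqP => [ep|_] vg; last first.
  by rewrite -vg eqxx in g0.
by apply: (p_out (p - e)%N); [apply: vI; rewrite -[co _ _]mul1r vg | lia].
Qed.

(** Distinct socle exponents would give independent classes in Ext^1(R/m, I), which is cyclic. The
    dependence relation is evaluated at [y], and the coefficient outside [m] decides which exponent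
    is compared. *)
Lemma socle_exp_unique p p' : socle_exp p -> socle_exp p' -> p = p'.
Proof.
move=> pP p'P; apply: contrapT => pp'; have [_ iso _] := omega_can.
have [phi [psi phiK psiK]] := I_can.
have m1 : (1 : R^o) \notin m.
  by apply/negP => /(in_maxidealP a_gt0)/eqP; rewrite co1 oner_eq0.
have [h hE] := socle_exp_hom pP; have [h' hE'] := socle_exp_hom p'P.
have [b [b' [rho [w [bb' rho1 relE]]]]] :=
  Ext1_residue_dependent iso m1 (phi \o h) (phi \o h').
have rho0 : co rho 0 = 1.
  move/(in_maxidealP a_gt0): rho1; rewrite coB co1 => /eqP.
  by rewrite subr_eq0 => /eqP.
pose ys : submod m := mkSub y_max.
have relI : rho *: (b *: h ys - b' *: h' ys) = y *: psi w.
  apply: (can_inj phiK); rewrite [RHS]linearZ_LR psiK -[y]/(val ys) -relE.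
  by rewrite [LHS]linearZ_LR [phi (_ - _)]linearB ![phi (_ *: _)]linearZ_LR.
have vE : tm k a fl p * (rho * b) - tm k a fl p' * (rho * b') = y * val (psi w).
  apply: (mono_reg y_mono (oner_neq0 _)).
  rewrite -[y * val (psi w)]/(val (y *: psi w)) -relI.
  exact: mul_relation (hE ys) (hE' ys).
have b0 : co (rho * b) 0 = co b 0 by rewrite co_mul_0 rho0 mul1r.
have b0' : co (rho * b') 0 = co b' 0 by rewrite co_mul_0 rho0 mul1r.
case/orP: bb' => /negP bm.
  apply: (socle_exp_separated pP p'P pp' _ (valP (psi w)) vE); rewrite b0.
  by apply/eqP => b00; apply/bm/in_maxidealP.
have vN : (- val (psi w) : R^o) \in I by rewrite submodN; exact: valP.
apply: (@socle_exp_separated p' p (rho * b') (rho * b) _ p'P pP _ _ vN).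
- by move/esym.
- by rewrite b0'; apply/eqP => b00; apply/bm/in_maxidealP.
by rewrite [RHS]mulrN -vE opprB.
Qed.

(** Take [P] to be the largest outside exponent, which is a socle exponent. Uniqueness yields the
    symmetry that [P - p] is in the semigroup for every outside [p]; applied to the small [p], which
    are all outside, it gives the conductor bound. *)
Lemma canonical_conductor : exists P,
  [/\ forall n, (P < n + e + d ord0)%N -> S n, (e + d ord0 <= P.+1)%N & outside P].
Proof.
have [N NS] := sg_cofinite a_gcd.
have out_le p : outside p -> (p <= e + d ord0 + N)%N.
  move=> p_out; rewrite leqNgt; apply/negP => lt_p.
  apply: (p_out (p - e)%N); last by lia.
  by exists ord0, (p - e - d ord0)%N; split; [apply: NS |]; lia.
have max_out (A : nat -> Prop) p0 : A p0 -> (forall p, A p -> outside p) ->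
    exists2 p, A p & forall p', A p' -> (p' <= p)%N.
  move=> Ap0 A_out; have exA : exists p, `[< A p >] by exists p0; exact/asboolP.
  have A_le p : `[< A p >] -> (p <= e + d ord0 + N)%N.
    by move=> /asboolP/A_out/out_le.
  have [p /asboolP Ap pmax] := ex_maxnP exA A_le.
  by exists p => // p' Ap'; apply/pmax/asboolP.
have not_out p : ~ outside p -> exists2 q, in_I q & p = (e + q)%N.
  move=> np; apply: contrapT => nq; apply: np => q qI pE; apply: nq; by exists q.
have out_small p : (p < e + d ord0)%N -> outside p.
  by move=> p_lt q /bad_in_I; lia.
have [P P_out Pmax] := max_out outside 0%N
  (out_small _ (ltn_addr _ (a_gt0 ord0))) (fun _ h => h).
have P_socle : socle_exp P.
  split=> // q qS q0; apply: not_out => /Pmax; lia.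
have P_sub p : outside p -> (p <= P)%N /\ S (P - p)%N.
  move=> p_out; split; first exact: Pmax.
  (* A largest outside element of [p + S] is a socle exponent, hence equals [P]. *)
  have [n [n_out [q qS nE]] nmax] := max_out
    (fun n => outside n /\ exists2 q, S q & n = (p + q)%N) p
    (conj p_out (ex_intro2 _ _ 0%N (in_sg0 a) (esym (addn0 p)))) (fun n => @proj1 _ _).
  have n_socle : socle_exp n.
    split=> // q' q'S q'0; apply: not_out => n'_out.
    have : (n + q' <= n)%N.
      apply: nmax; split=> //; exists (q + q')%N; first exact: in_sgD.
      by rewrite nE addnA.
    by lia.
  by rewrite (socle_exp_unique P_socle n_socle) nE addKn.
have P_ge : (e + d ord0 <= P.+1)%N.
  have := a_gt0 ord0 => e0.
  by have [|+ _] := P_sub (e + d ord0).-1; [apply: out_small|]; lia.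
exists P; split=> //.
elim/ltn_ind => n IHn Pn; have [nP|Pn'] := leqP n P.
  have [|_] := P_sub (P - n)%N; first by apply: out_small; lia.
  by rewrite subKn.
rewrite -(@subnK e n); last by lia.
apply: in_sgD e_sg; apply: IHn; have := a_gt0 ord0; lia.
Qed.

Lemma Ext1_e_colon : ann y (Ext 1 (submod I) R^o) -> e_colon.
Proof.
move=> yE; apply: contrapT => /bad_generator[j j0 bad].
have [P [P_sg P_ge P_out]] := canonical_conductor.
exact: (bad_Ext1 j0 bad P_sg P_ge P_out yE).
Qed.

End Canonical.

(** * The graded syzygy module *)

Section SyzygyModule.
Local Notation up := (fintype.lift (@ord0 r)).
Local Notation mr := {ffun 'I_r -> submod m}.

(** The map forgets the coordinate at [ord0]. This coordinate is determined because [X ord0] is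
    regular, and exists because [m I] lies in [(X ord0)]. *)
Lemma e_colon_syzygies : e_colon ->
  exists2 f : {linear submod (Z1 X) -> mr}, bijective f &
    forall u i, val (f u i) = val u (up i).
Proof.
move=> ye; have zm (u : submod (Z1 X)) i : val u i \in m.
  by apply/in_maxidealP => //; exact: Z1_max (valP u).
have fL : linear (fun u : submod (Z1 X) => [ffun i => mkSub (zm u (up i))] : mr).
  by move=> b u v; apply/ffunP => i; apply/val_inj; rewrite !ffunE /= !ffunE.
have f_inj : injective (mkLinear fL).
  move=> u v uv; have E i : val u (up i) = val v (up i).
    by have := congr1 (fun w : mr => val (w i)) uv; rewrite /= !ffunE.
  apply/val_inj/ffunP => i; case: (unliftP ord0 i) => [i' ->|->]; first exact: E.
  have dot0 (w : submod (Z1 X)) : dot X (val w) = 0 by exact/eqP/(valP w).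
  have := dot0 u; rewrite -(dot0 v) /dot !big_ord_recl.
  move=> u0; apply: X_ord0_reg; move: u0; rewrite (eq_bigr _ (fun i _ => congr1 (fun w => w *: _) (E i))).
  by move/addIr; rewrite -![_ *: _]/(_ * _) ![X ord0 * _]mulrC.
have f_surj w : exists u, mkLinear fL u = w.
  have /choice[g gE] i : exists g, X ord0 * g = (val (w i) : R) * X (up i).
    have [g gE] := (colonP _).1 (e_colon_max ye (valP (w i))) _ (X_in (up i)).
    by exists g.
  pose z : {ffun 'I_r.+1 -> R^o} :=
    [ffun i => if unlift ord0 i is Some i' then val (w i') else - \sum_i g i].
  have zZ : z \in Z1 X.
    apply/eqP; rewrite /= /dot big_ord_recl ffunE unlift_none.
    rewrite -[_ *: _]/(_ * _) mulNr mulr_suml addrC; apply/eqP.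
    rewrite subr_eq0; apply/eqP/eq_bigr => i _.
    by rewrite ffunE liftK -[_ *: _]/(_ * _) -gE mulrC.
  exists (mkSub zZ); apply/ffunP => i; apply/val_inj.
  by rewrite /= ffunE /= ffunE liftK.
have /choice[h hP] := f_surj; exists (mkLinear fL); last first.
  by move=> u i; rewrite /= ffunE.
by exists h => [u|w]; [apply/f_inj/hP | exact: hP].
Qed.

(** Only the coordinate at [ord0] is at stake, and the relation gives it the degree of the
    others. *)
Lemma Z1_homog (z : {ffun 'I_r.+1 -> R^o}) (n : int) : z \in Z1 X ->
  (forall i p, co (z (up i) : R) p != 0 -> (p + d (up i))%:Z = n) ->
  forall i p, co (z i : R) p != 0 -> (p + d i)%:Z = n.
Proof.
move=> /eqP zX zP i p; case: (unliftP ord0 i) => [i' ->|->]; first exact: zP.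
move=> zp; have := congr1 (fun h : R => co h (d ord0 + p)%N) zX.
rewrite /= /dot big_ord_recl coD co0 co_sum.
rewrite -[z ord0 *: _]/(_ * _) mulrC (mono_mulD _ _ (X_mono ord0)) => sum0.
have [[l lP]|no_l] := pselect (exists l : 'I_r,
    co ((z (up l) : R) * X (up l)) (d ord0 + p)%N != 0).
  move: lP; rewrite mulrC (mono_mul _ _ (X_mono _)).
  case: leqP => // [dl|_]; last by rewrite eqxx.
  rewrite mulf_eq0 negb_or => /andP[_ /zP].
  by rewrite subnK // addnC.
move: sum0; rewrite big1 ?addr0 => [/eqP|l _].
  by rewrite mulf_eq0 (negPf (c_neq0 _)) (negPf zp).
by apply/eqP/negPn/negP => lP; apply: no_l; exists l.
Qed.

Lemma const_exists (b : k) : exists g : R, is_mono g b 0.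
Proof.
have [n|n|g gE] := @co_exists k s a fl (fun n => if n == 0%N then b else 0) 1 0.
- by case: (n =P 0%N) => [-> _|_]; [exact: in_sg0 | rewrite eqxx].
- case: (n =P 0%N) => [-> _|_]; last by rewrite eqxx.
  by exists 0%N; rewrite ?co1 ?oner_eq0.
by exists g.
Qed.

(* If y x_t lies in no (x_i) with i <> t, the degree |y x_t| part of Z_1 has
   smaller dimension than that of the sum of the shifted copies of m. *)
Lemma syzygies_e_colon (f : {linear submod (Z1 X) -> mr}) : bijective f ->
  (forall (n : int) u,
     (forall i p, co (val (f u i) : R) p != 0 -> (p + d (up i))%:Z = n) ->
     forall i p, co (val u i : R) p != 0 -> (p + d i)%:Z = n) ->
  e_colon.
Proof.
move=> [g fK gK] f_gr; apply: contrapT => /bad_generator[t t0 bad].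
pose N := (e + d t)%N; pose d' i := d (up i).
(* The summands that are nonzero in degree [N], each with a one-dimensional part spanned by [ev i].
   The preimages [zeta i] of these vectors are cycles of degree [N]. *)
pose A i := `[< (d' i <= N)%N /\ S (N - d' i)%N >].
have /choice[ev evE] i : exists v : submod m,
    is_mono (val v : R) (if A i then 1 else 0) (N - d' i)%N.
  have [/asboolP[dN NS]|_] := boolP (A i); last first.
    by exists 0 => n; rewrite co0 if_same.
  have tmE := tm_mono k fl NS; suff tm_m : (tm k a fl (N - d' i)%N : R^o) \in m.
    by exists (mkSub tm_m).
  apply/in_maxidealP => //; rewrite tmE; case: eqP => // /esym/eqP.
  rewrite subn_eq0 => Nd; have dE : d' i = (d t + e)%N by rewrite /N in dN Nd; lia.
  by have dt := d_min e_sg dE; move: dE; rewrite /d' dt; have := e_neq0; lia.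
pose eps i : mr := [ffun l => if l == i then ev i else 0].
pose zeta i := g (eps i).
have zeta_gr i l p : co (val (zeta i) l : R) p != 0 -> (p + d l = N)%N.
  move=> zp; apply/eqP; rewrite -eqz_nat; apply/eqP; move: l p zp.
  apply: f_gr => l p; rewrite gK ffunE; case: (l =P i) => [->|_].
    rewrite evE; have [/asboolP[dN NS]|_] := boolP (A i); last by rewrite if_same eqxx.
    by case: (p =P N - d' i)%N => [-> _|]; [rewrite subnK | rewrite eqxx].
  by rewrite co0 eqxx.
(* A nonzero term here would give [e + d t = p + d ord0], against the choice of [t]. *)
have zeta0 i : val (zeta i) ord0 = 0.
  apply: co_inj => p; rewrite co0; apply/eqP/negPn/negP => zp.
  apply: (bad ord0 p _ (co_sg zp)); first by rewrite eq_sym.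
  by rewrite addnC -[RHS]addnC (zeta_gr _ _ _ zp) /N addnC.
pose B i l := if (d' l <= N)%N then co (val (zeta i) (up l) : R) (N - d' l)%N else 0.
have BA i l : ~~ A l -> B i l = 0.
  rewrite /B; case: ifP => // dN /asboolPn Al; apply/eqP/negPn/negP => /co_sg NS.
  exact: Al.
have B_nA i l : ~~ A i -> B i l = 0.
  move=> Ai; have eps0 : eps i = 0.
    apply/ffunP => h; rewrite !ffunE; case: ifP => // _.
    by apply/val_inj/co_inj => n; rewrite evE (negPf Ai) if_same [RHS]co0.
  have z0 : zeta i = 0 by rewrite /zeta eps0 -(linear0 f) fK.
  by rewrite /B z0 ffunE co0 if_same.
have B_rel i : \sum_l B i l * c (up l) = 0.
  have dot0 : dot X (val (zeta i)) = 0 by exact/eqP/(valP (zeta i)).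
  have := congr1 (fun h : R => co h N) dot0.
  rewrite /dot big_ord_recl zeta0 scale0r add0r co0 co_sum => sumE; rewrite -[RHS]sumE.
  apply: eq_bigr => l _; rewrite -[_ *: _]/(_ * _) [X in co X]mulrC.
  by rewrite (mono_mul _ _ (X_mono _)) /B /d'; case: ifP; rewrite ?mul0r // mulrC.
(* The coefficient matrix [B] is supported on the block [A] and is completed by the identity outside
   it. The cycle relation puts [kap] in its kernel, and [A t'] makes [kap] nonzero. *)
pose M : 'M[k]_r := \matrix_(i, l) (B i l + (if A i then 0 else (i == l)%:R)).
pose kap : 'rV[k]_r := \row_l (if A l then c (up l) else 0).
have [t' tE] : exists t', t = up t'.
  by case: (unliftP ord0 t) t0 => [t' -> _|->]; [exists t' | rewrite eqxx].
have At' : A t'.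
  by apply/asboolP; rewrite /d' -tE /N leq_addl addnK; split=> //; exact: e_sg.
have detM : \det M == 0.
  rewrite -det_tr; apply/det0P; exists kap.
    by apply/eqP => /rowP/(_ t'); rewrite !mxE At'; apply/eqP.
  apply/rowP => i; rewrite !mxE; under eq_bigr do rewrite !mxE.
  rewrite -[RHS](B_rel i); have [Ai|Ai] := boolP (A i).
    apply: eq_bigr => l _; rewrite addr0 mulrC.
    by case: (boolP (A l)) => // Al; rewrite BA // !mul0r.
  rewrite (bigD1 i) //= (negPf Ai) mul0r add0r [RHS]big1; last first.
    by move=> l _; rewrite B_nA // mul0r.
  by rewrite big1 // => l li; rewrite B_nA // add0r eq_sym (negPf li) mulr0.
(* A left kernel vector, supported on [A], is a linear relation among the [zeta i]; applying [f]
   turns it into one among the independent [eps i]. *)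
have [u u0 /rowP uM] := det0P detM.
have uA l : ~~ A l -> u ord0 l = 0.
  move=> Al; have := uM l; rewrite !mxE; under eq_bigr do rewrite !mxE.
  rewrite (bigD1 l) //= BA // (negPf Al) eqxx add0r mulr1 big1 ?addr0 //.
  by move=> i il; rewrite BA // add0r (negPf il) if_same mulr0.
have uB l : \sum_i u ord0 i * B i l = 0.
  have [Al|Al] := boolP (A l); last by apply: big1 => i _; rewrite BA // mulr0.
  have := uM l; rewrite !mxE => uMl; rewrite -[RHS]uMl; apply: eq_bigr => i _.
  rewrite mxE; have [Ai|Ai] := boolP (A i); first by rewrite addr0.
  by case: (i =P l) Ai => [->|_ _]; rewrite ?Al // addr0.
have /choice[kc kcE] := const_exists.
pose z : submod (Z1 X) := \sum_i kc (u ord0 i) *: zeta i.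
have coz l p : co (val z l : R) p = \sum_i u ord0 i * co (val (zeta i) l : R) p.
  rewrite /z linear_sum sum_ffunE co_sum; apply: eq_bigr => i _.
  rewrite linearZ ffunE -[_ *: _]/(_ * _).
  by rewrite -{1}[p]add0n (mono_mulD _ _ (kcE _)).
have z0 : z = 0.
  apply/val_inj/ffunP => l; apply: co_inj => p; rewrite coz ffunE co0.
  case: (unliftP ord0 l) => [l' ->|->]; last first.
    by apply: big1 => i _; rewrite zeta0 co0 mulr0.
  case: (eqVneq (p + d' l')%N N) => [pN|pN]; last first.
    apply: big1 => i _; rewrite [X in _ * X](_ : _ = 0) ?mulr0 //.
    by apply/eqP/negPn/negP => /zeta_gr /eqP; rewrite (negPf pN).
  rewrite -[RHS](uB l'); apply: eq_bigr => i _.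
  by rewrite /B -pN leq_addl addnK.
case/eqP: u0; apply/rowP => l; rewrite mxE.
have [Al|/uA//] := boolP (A l).
have : f z l = 0 by rewrite z0 linear0 ffunE.
rewrite /z linear_sum sum_ffunE => /(congr1 val).
rewrite linear_sum (bigD1 l) //= big1 => [|i il]; last first.
  by rewrite linearZ ffunE gK ffunE eq_sym (negPf il) scaler0.
rewrite addr0 linearZ ffunE gK ffunE eqxx /=.
move/(congr1 (fun h : R => co h (N - d' l)%N)); rewrite -[_ *: _]/(_ * _) co0.
by rewrite -{1}[(N - _)%N]add0n (mono_mulD _ _ (kcE _)) evE Al eqxx mulr1.
Qed.

Lemma graded_syzygies :
  e_colon <-> exists2 f : {linear submod (Z1 X) -> mr}, bijective f &
    forall (n : int) u,
      (forall i p, co (val (f u i) : R) p != 0 -> (p + d (up i))%:Z = n) <->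
      (forall i p, co (val u i : R) p != 0 -> (p + d i)%:Z = n).
Proof.
split=> [/e_colon_syzygies[f f_bij fE]|[f f_bij f_gr]].
  exists f => // n u; split=> uP i p; last by rewrite fE; exact: uP.
  apply: (Z1_homog (valP u)) i p => i p; rewrite -fE; exact: uP.
by apply: (syzygies_e_colon f_bij) => n u; exact: (f_gr n u).1.
Qed.

End SyzygyModule.

End MonomialIdeal.

(** * The graded isomorphism over the polynomial ring *)

Section GradedSyzygies.
Variables (k : fieldType) (s : nat) (a : 'I_s.+1 -> nat).
Hypothesis a_gt0 : forall i, (0 < a i)%N.
Hypothesis a_incr : forall i j : 'I_s.+1, (i < j)%N -> (a i < a j)%N.
Hypothesis sg_sum : forall p q, in_sg a p -> in_sg a q -> p <> 0%N ->
  q <> 0%N -> in_sg a (p + q - a ord0)%N.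
Variables (r : nat) (x : 'I_r.+1 -> graded_sgring k a).
Variables (c : 'I_r.+1 -> k) (d : 'I_r.+1 -> nat).
Hypothesis x_mono : forall i, is_mono (fl := Graded) (x i) (c i) (d i).
Hypothesis c_neq0 : forall i, c i != 0.
Hypothesis d_incr : forall i j : 'I_r.+1, (i < j)%N -> (d i < d j)%N.
Hypothesis d_min : forall i j q, in_sg a q -> d i = (d j + q)%N -> i = j.

Lemma homog_sub (n : int) (p : nat) (h : graded_sgring k a) :
  homog (n - p%:Z) h <->
  forall q, co (fl := Graded) h q != 0 -> (q + p)%:Z = n.
Proof. by split=> hP q hq; have := hP q hq; lia. Qed.

Lemma homog_family (J : Type) (n : int) (b : J -> nat)
    (h : J -> graded_sgring k a) :
  (forall i, homog (n - (b i)%:Z) (h i)) <->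
  (forall i q, co (fl := Graded) (h i) q != 0 -> (q + b i)%:Z = n).
Proof. by split=> hP i; apply/homog_sub/hP. Qed.

(** Since [e_colon] involves exponents only, it links the graded statement to the other conditions
    in either flavor. *)
Lemma gisom_e_colon :
  gisom (gsubmod (M := gsum_shift (graded_self k a) d) (Z1 x))
    (gsum_shift (gsubmod (M := graded_self k a) (maxideal k a Graded))
       (fun i : 'I_r => d (fintype.lift ord0 i))) <-> e_colon a d.
Proof.
have := graded_syzygies a_gt0 a_incr sg_sum x_mono c_neq0 d_incr d_min
  (I := spanm (range (x : 'I_r.+1 -> (sgring k a Graded)^o))) (fun=> erefl).
move=> ->; split=> [[f f_bij f_gr]|[f f_bij f_gr]]; exists f => // n u.
  exact: iff_trans (iff_sym (homog_family n
    (fun i : 'I_r => d (fintype.lift ord0 i)) (fun i => val (f u i))))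
    (iff_trans (f_gr n u) (homog_family n d (val u))).
exact: iff_trans (homog_family n
  (fun i : 'I_r => d (fintype.lift ord0 i)) (fun i => val (f u i)))
  (iff_trans (f_gr n u) (iff_sym (homog_family n d (val u)))).
Qed.

End GradedSyzygies.

(** * Equivalence of the sixteen conditions *)

Theorem theorem4p10 (k : fieldType) (s : nat) (a : 'I_s.+1 -> nat)
    (a_gt0 : forall i, (0 < a i)%N)
    (a_incr : forall i j : 'I_s.+1, (i < j)%N -> (a i < a j)%N)
    (a_gcd : \big[gcdn/0%N]_i a i = 1%N)
    (fl : flavor) :
  let R := sgring k a fl in
  let m := maxideal k a fl in
  let y : R := iota_sg fl (tpow k a ord0) in
  forall (R_minmult : minimal_multiplicity k a fl)
    (omega : lmodType R) (omega_can : canonical_module m omega)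
    (I : ideal R) (I_homog : homogeneous_ideal I)
    (I_can : isom (submod I) omega)
    (r : nat) (x : 'I_r.+1 -> graded_sgring k a) (d : 'I_r.+1 -> nat)
    (x_neq0 : forall i, x i != 0)
    (x_homog : forall i, homog (d i)%:Z (x i))
    (d_incr : forall i j : 'I_r.+1, (i < j)%N -> (d i < d j)%N)
    (x_gen : min_generates (fun i => iota_sg fl (x i) : R^o) I),
  let X i : R := iota_sg fl (x i) in
  [<-> (* 1 *) (forall z : R, z \in m -> colon (X ord0) I z);
       (* 2 *) (forall z : R, z \in m -> z \in trace omega);
       (* 3 *) (forall i, (0 < i)%N ->
                 forall z : R, z \in m -> ann z (Ext i (submod I) R^o));
       (* 4 *) (forall z : R, z \in m -> ann z (Ext 1 (submod I) R^o));
       (* 5 *) (forall z : R, z \in m -> ann z (Tor 1 (submod I) (quotmod I)));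
       (* 6 *) (forall z : R, z \in m -> ann z (ext2 (submod I)));
       (* 7 *) {subset smulm m (B1 X) <= smulm I (Z1 X)};
       (* 8 *) (forall b, b \in B1 X -> y *: b \in smulm I (Z1 X));
       (* 9 *) colon (X ord0) I y;
       (* 10 *) (forall i, (0 < i)%N -> ann y (Ext i (submod I) R^o));
       (* 11 *) ann y (Ext 1 (submod I) R^o);
       (* 12 *) ann y (Tor 1 (submod I) (quotmod I));
       (* 13 *) ann y (ext2 (submod I));
       (* 14 *) y \in trace (submod I);
       (* 15 *) (exists L : ideal R, isom (submod I) (submod L) /\ y \in L);
       (* 16 *) gisom
                  (gsubmod (M := gsum_shift (graded_self k a) d) (Z1 x))
                  (gsum_shift
                    (gsubmod (M := graded_self k a) (maxideal k a Graded))
                    (fun i : 'I_r => d (lift ord0 i)))].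
Proof.
move=> R m y minmult omega omega_can I _ I_can r x d x_neq0 x_homog d_incr x_gen X.
have sg_sum p q := @minmult_sum k s a fl a_gt0 a_gcd p q minmult.
pose c i := (val (x i))`_(d i).
have x_coef i n : (val (x i))`_n = if n == d i then c i else 0.
  case: eqP => [->//|nd]; apply/eqP/negPn/negP => /x_homog [dn].
  exact: nd.
have x_mono i : is_mono (fl := Graded) (x i) (c i) (d i).
  by move=> n; rewrite -x_coef.
have X_mono i : is_mono (X i) (c i) (d i).
  by move=> n; rewrite co_iota x_coef.
have c_neq0 i : c i != 0.
  apply: contra (x_neq0 i) => /eqP c0; apply/eqP/val_inj/polyP => n.
  by rewrite x_coef c0 if_same coef0.
have [X_gen X_min] := x_gen.
have d_min i j q : in_sg a q -> d i = (d j + q)%N -> i = j.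
  move=> qS dE; apply: contrapT => ij; case/negP: (X_min i).
  apply/(span_monoP _ (X i) X_mono c_neq0) => n; rewrite X_mono.
  case: (n =P d i) => [-> _|_]; last by rewrite eqxx.
  by exists j, q; split=> //; apply/eqP => ji; apply: ij.
have y_mono : is_mono y 1 (a ord0).
  by move=> n; rewrite co_iota /= coefXn; case: eqP.
have ym : (y : R^o) \in m := y_max a_gt0 y_mono.
have colonE := e_colonP X_mono c_neq0 X_gen y_mono.
have colon_m := e_colon_max a_gt0 a_incr sg_sum X_mono c_neq0 d_incr X_gen.
have factor z := @colon_free_factor _ _ _ _ _ _ _ _ _ X_mono c_neq0 X_gen z.
have tr_e := trace_e_colon a_gt0 a_incr X_mono c_neq0 d_incr d_min X_gen y_mono.
have ext1_e := Ext1_e_colon a_gt0 a_incr sg_sum X_mono c_neq0 d_incr d_min X_gen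
  y_mono omega_can I_can a_gcd.
have tor1_e :=
  Tor1_e_colon a_gt0 a_incr sg_sum X_mono c_neq0 d_incr d_min X_gen y_mono.
have ext2_e :=
  ext2_e_colon a_gt0 a_incr sg_sum X_mono c_neq0 d_incr d_min X_gen y_mono.
have kos_e :=
  kos_e_colon a_gt0 a_incr sg_sum X_mono c_neq0 d_incr d_min X_gen y_mono.
have e_ext2 := e_colon_ext2 a_gt0 a_incr sg_sum X_mono c_neq0 d_incr X_gen.
have e_kos := e_colon_kos a_gt0 a_incr sg_sum X_mono c_neq0 d_incr X_gen.
have e_ideal := e_colon_ideal X_mono c_neq0 X_gen y_mono.
have gisomE := gisom_e_colon a_gt0 a_incr sg_sum x_mono c_neq0 d_incr d_min.
(* Apart from specializations and direct consequences of the colon condition, each implication of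
   the cycle goes through [e_colon]. *)
tfae.
- move=> mI z zm; apply: (trace_sub I_can).
  exact/(colon_trace X_mono c_neq0 X_gen)/mI.
- move=> tr i i_gt0 z zm; apply: free_factor_Ext => //; apply/factor/colon_m => //.
  exact/tr_e/(trace_sub (isom_sym I_can))/tr.
- by move=> ext_m; exact: ext_m.
- move=> ext_m z zm; apply/free_factor_Tor/factor/colon_m => //.
  exact/ext1_e/ext_m.
- by move=> tor_m z zm; apply: e_ext2 => //; exact/tor1_e/tor_m.
- by move=> ext_m; apply/e_kos/ext2_e/ext_m.
- move=> mB b bB; apply: mB; exact: sub_smulm.
- by move=> /kos_e/colonE.
- by move=> /factor yI i i_gt0; exact: free_factor_Ext.
- by move=> ext_y; exact: ext_y.
- by move=> /ext1_e/colonE/factor; exact: free_factor_Tor.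
- by move=> /tor1_e ye; exact: e_ext2.
- by move=> /ext2_e/colonE/(colon_trace X_mono c_neq0 X_gen).
- by move=> /tr_e; exact: e_ideal.
- by move=> [L [IL yL]]; apply/gisomE/tr_e; exact: ideal_trace IL yL.
by move=> /gisomE; exact: colon_m.
Qed.
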